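(* Let $\mathfrak f\in\mathcal C_{\mathbf Q}^{\{w\},(i,j)}$ be a non-constant covariant functional in ghost-bidegree $(i,j)\in\mathbb Z^2$ and tensor density weight $w\in\mathbb R$. Then, if $\mathfrak f$ does not involve graviton-ghosts $C$ and graviton-antighosts $\overline C$, the following statements are equivalent: 1. $w=1$; 2. $P\mathfrak f\simeq_{\mathrm{TD}}0$; 3. $\overline P\mathfrak f\simeq_{\mathrm{TD}}0$, where $\simeq_{\mathrm{TD}}$ means equality modulo total derivatives. In particular, every functional can be modified uniquely to satisfy condition 1.
   Context: Setting. $(M,g)$ is a spacetime (smooth, connected, time-orientable Lorentzian manifold) with $g_{\mu\nu}=\eta_{\mu\nu}+\varkappa h_{\mu\nu}$, $\eta$ the Minkowski background metric, $h$ the graviton, $\varkappa$ the graviton coupling constant, $\Gamma^\rho{}_{\mu\nu}$ the Christoffel symbols of $g$; $\zeta$ is a gauge fixing parameter. Fields with bidegree (graviton-ghost degree, gauge ghost degree): $h_{\mu\nu}$, vielbein $e$, gauge boson $A^a_\mu$, Higgs/Goldstone vector $\Phi$, fermion vector $\Psi$, auxiliary (Lautrup–Nakanishi) fields $B^\rho$, $b_a$ of degree $(0,0)$; graviton-ghost $C_\rho$: $(1,0)$; graviton-antighost $\overline C^\rho$: $(-1,0)$; gauge ghost $c^a$: $(0,1)$; gauge antighost $\overline c_a$: $(0,-1)$. Parity is total degree mod 2. Spacetime indices are raised and lowered with metrics in ghost degree zero, gauge indices with $\delta_{ab}$. $\mathcal C_{\mathbf Q}$ is the superalgebra of functionals of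 particle fields, i.e. graded-symmetric polynomials in the dual of the space of fields; $\mathcal C_{\mathbf Q}^{\{w\},(i,j)}$ is its subspace of graviton-ghost degree $i$, gauge ghost degree $j$ and tensor density weight $w$, i.e. of functionals $\mathfrak f=(-\mathrm{Det}(g))^{w/2}f$ with $f$ an ordinary covariant functional of weight $0$ in that bidegree. Diffeomorphism BRST operator $P$ (odd superderivation of bidegree $(1,0)$ with $P\partial_\mu=0$): $Ph_{\mu\nu}=\frac1\zeta\partial_\mu C_\nu+\frac1\zeta\partial_\nu C_\mu-2C_\rho\Gamma^\rho{}_{\mu\nu}$; $PC_\rho=\varkappa C^\sigma(\partial_\sigma C_\rho)$; $P\overline C^\rho=\frac1\zeta B^\rho$; $PB^\rho=0$; $P\eta_{\mu\nu}=0$; $P\delta_{ab}=0$; $PA^a_\mu=\varkappa\big(C^\rho(\partial_\rho A^a_\mu)+(\partial_\mu C^\rho)A^a_\rho\big)$; $Pc^a=\varkappa C^\rho(\partial_\rho c^a)$; $P\overline c_a=\varkappa C^\rho(\partial_\rho\overline c_a)$; $Pb_a=\varkappa C^\rho(\partial_\rho b_a)$; $P\Phi=\varkappa C^\rho(\partial_\rho\Phi)$; $P\Psi=\varkappa\big(C^\rho\nabla^{\Sigma M}_\rho\Psi+\frac{\mathrm i}4(\partial_\mu C_\nu-\partial_\nu C_\mu)e^{\mu m}e^{\nu n}\boldsymbol\sigma_{mn}\Psi\big)$, with $\nabla^{\Sigma M}$ the covariant derivative on the twisted spinor bundle, $e^{\mu m}$ the inverse vielbein, and the last expression being Kosmann's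 formula for the Lie derivative of spinors; in general, on all fields $\varphi\notin\{h,C,\overline C,B,\eta\}$, $P\varphi=\varkappa\mathcal L_C\varphi$ is $\varkappa$ times the Lie derivative along $C$. Diffeomorphism anti-BRST operator $\overline P$ (bidegree $(-1,0)$): obtained from $P$ by replacing $C$ by $\overline C$, with the changes $\overline PC_\rho=-\frac1\zeta B_\rho+\varkappa\overline C^\sigma(\partial_\sigma C_\rho)+\varkappa(\partial_\rho\overline C^\sigma)C_\sigma$, $\overline P\,\overline C^\rho=\varkappa\overline C^\sigma(\partial_\sigma\overline C^\rho)$, $\overline PB^\rho=\varkappa\overline C^\sigma(\partial_\sigma B^\rho)-\varkappa(\partial_\sigma\overline C^\rho)B^\sigma$.
   Formalization: The gauge parameter ζ is set to 1 (otherwise Ph and P̄h are not Lie derivatives of the metric and f=√-g is a counterexample); statement 2 is claimed only if f does not involve B^ρ (PB=0 breaks f=√-g g_{μν}B^μB^ν); the final claim is for nonzero f. *)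

(* Defs.v *)
From HB Require Import structures.
From mathcomp Require Import all_boot all_order all_algebra.
From mathcomp Require Import finmap.
From mathcomp.multinomials Require mpoly monalg.
From mathcomp.real_closed Require Import complex.
From mathcomp Require Import boolp reals.

Set Implicit Arguments.
Unset Strict Implicit.
Unset Printing Implicit Defensive.
Import Order.TTheory GRing.Theory Num.Theory.
Local Open Scope ring_scope.

Module PowerSeries.
Import mpoly.

(* formal power series in n variables over K *)
Definition mps (n : nat) (K : Type) := 'X_{1..n} -> K.

Section Ring.
Variables (n : nat) (K : comNzRingType).
Implicit Types f g h : mps n K.

HB.instance Definition _ := gen_eqMixin (mps n K).
HB.instance Definition _ := gen_choiceMixin (mps n K).

Definition mps0 : mps n K := fun=> 0.
Definition mps_opp f : mps n K := fun m => - f m.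
Definition mps_add f g : mps n K := fun m => f m + g m.

Fact mps_addA : associative mps_add.
Proof. by move=> f g h; apply/funext => m; rewrite /mps_add addrA. Qed.
Fact mps_addC : commutative mps_add.
Proof. by move=> f g; apply/funext => m; rewrite /mps_add addrC. Qed.
Fact mps_add0 : left_id mps0 mps_add.
Proof. by move=> f; apply/funext => m; rewrite /mps_add add0r. Qed.
Fact mps_addN : left_inverse mps0 mps_opp mps_add.
Proof. by move=> f; apply/funext => m; rewrite /mps_add addNr. Qed.

HB.instance Definition _ :=
  GRing.isZmodule.Build (mps n K) mps_addA mps_addC mps_add0 mps_addN.

Definition mpsC (c : K) : mps n K := fun m => c *+ (m == 0%MM).
Definition mpsX (i : 'I_n) : mps n K := fun m => (m == U_(i)%MM)%:R.
Definition mps_mul f g : mps n K := fun m =>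
  \sum_(k : 'X_{1..n < (mdeg m).+1} | (k <= m)%MM) f k * g (m - k)%MM.

Let trunc N f : {mpoly K[n]} := \sum_(m : 'X_{1..n < N}) f m *: 'X_[m].

Let truncE N f m : (mdeg m < N)%N -> (trunc N f)@_m = f m.
Proof. exact: mcoeff_mpoly. Qed.

Let mps_mulE N f g m : (mdeg m < N)%N ->
  mps_mul f g m = (trunc N f * trunc N g)@_m.
Proof.
move=> ltmN; rewrite (@mcoeff_poly_mul_lin _ _ _ _ m (mdeg m).+1) //.
apply: eq_bigr => k lekm; have ltk : (mdeg k <= mdeg m)%N by rewrite -ltnS bmdeg.
rewrite !truncE //; last exact: leq_ltn_trans ltk ltmN.
exact: leq_ltn_trans (mdegB _ _) ltmN.
Qed.

Let eq_coefM (p q r s : {mpoly K[n]}) m :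
    (forall k, (mdeg k <= mdeg m)%N -> p@_k = r@_k) ->
    (forall k, (mdeg k <= mdeg m)%N -> q@_k = s@_k) ->
  (p * q)@_m = (r * s)@_m.
Proof.
move=> pr qs; rewrite !(@mcoeff_poly_mul_lin _ _ _ _ m (mdeg m).+1) //.
apply: eq_bigr => k _; rewrite pr ?qs ?mdegB //.
by rewrite -ltnS bmdeg.
Qed.

Let trunc_mul N f g m : (mdeg m < N)%N ->
  (trunc N (mps_mul f g))@_m = (trunc N f * trunc N g)@_m.
Proof. by move=> h; rewrite truncE // (mps_mulE _ _ h). Qed.

Fact mps_mulA : associative mps_mul.
Proof.
move=> f g h; apply/funext => m; pose N := (mdeg m).+1.
rewrite !(@mps_mulE N) ?ltnS //.
transitivity (trunc N f * (trunc N g * trunc N h))@_m.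
  by apply: eq_coefM => // k lek; rewrite trunc_mul.
by rewrite mulrA; apply: eq_coefM => // k lek; rewrite trunc_mul.
Qed.

Fact mps_mulC : commutative mps_mul.
Proof.
by move=> f g; apply/funext => m; rewrite !(@mps_mulE (mdeg m).+1) // mulrC.
Qed.

Fact mps_mul1 : left_id (mpsC 1) mps_mul.
Proof.
move=> f; apply/funext => m; pose N := (mdeg m).+1; rewrite (@mps_mulE N) //.
rewrite -[RHS](@truncE N) // -[in RHS](mul1r (trunc N f)).
apply: eq_coefM => // k lek; rewrite truncE // mcoeff1 /mpsC.
by case: eqP.
Qed.

Fact mps_mulDl : left_distributive mps_mul +%R.
Proof.
move=> f g h; apply/funext => m; rewrite -[RHS]/(mps_mul f h m + mps_mul g h m) /mps_mul -big_split /=.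
by apply: eq_bigr => k _; rewrite -mulrDl.
Qed.

Fact mps_1_neq0 : mpsC 1 != 0.
Proof.
by apply/eqP => /(congr1 (fun f => f 0%MM)) /eqP; rewrite /mpsC eqxx oner_eq0.
Qed.

HB.instance Definition _ := GRing.Zmodule_isComNzRing.Build (mps n K)
  mps_mulA mps_mulC mps_mul1 mps_mulDl mps_1_neq0.

Definition mps_deriv (i : 'I_n) f : mps n K :=
  fun m => f (m + U_(i))%MM *+ (m i).+1.
End Ring.

Section Pow.
Variables (n : nat) (K : fieldType).

Definition gbin (a : K) (k : nat) : K := (\prod_(j < k) (a - j%:R)) / k`!%:R.

(* f ^ a for an arbitrary exponent a, by the binomial series; meaningful when
   f has constant coefficient 1, where (f - 1) ^+ k has no monomial of degree
   less than k *)
Definition mps_pow (f : mps n K) (a : K) : mps n K :=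
  fun m => \sum_(k < (mdeg m).+1) gbin a k * ((f - 1) ^+ k) m.
End Pow.
End PowerSeries.

Module SuperAlgebra.
Import monalg.
Local Open Scope fset_scope.

Section Def.
Variables (L : comNzRingType) (X : choiceType) (Y : countType).

(* a monomial is an (ordinary) monomial in the even generators times the
   product, in increasing order, of a finite set of odd generators *)
Definition smonom : Type := ({cmonom X} * {fset Y})%type.
HB.instance Definition _ := Choice.on smonom.

Definition smul (k l : smonom) : smonom := (mmul k.1 l.1, k.2 `|` l.2).
Definition sone : smonom := (mone, fset0).

(* the number of transpositions needed to sort the product of S and T *)
Definition ninv (S T : {fset Y}) : nat :=
  \sum_(s <- S) \sum_(t <- T) (choice.pickle t < choice.pickle s)%N.

Definition ssign (k l : smonom) : L :=
  if [disjoint k.2 & l.2]%fset then (-1) ^+ ninv k.2 l.2 else 0.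

Lemma smulA : associative smul.
Proof. by move=> a b c; rewrite /smul /= mulmA fsetUA. Qed.
Lemma smul1 : left_id sone smul.
Proof. by case=> m S; rewrite /smul /= mul1m fset0U. Qed.
Lemma smulr1 : right_id sone smul.
Proof. by case=> m S; rewrite /smul /= mulm1 fsetU0. Qed.

Lemma ssign1 k : ssign sone k = 1.
Proof. by rewrite /ssign fdisjoint0X /ninv big_seq_fset0. Qed.
Lemma ssignr1 k : ssign k sone = 1.
Proof.
rewrite /ssign fdisjointX0 /ninv big1 // => s _; exact: big_seq_fset0.
Qed.

Lemma sum_fsetU (S T : {fset Y}) (F : Y -> nat) : [disjoint S & T] ->
  \sum_(s <- S `|` T) F s = (\sum_(s <- S) F s + \sum_(s <- T) F s)%N.
Proof.
move=> dST; rewrite -big_cat /=; apply/perm_big/uniq_perm.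
- exact: fset_uniq.
- rewrite cat_uniq !fset_uniq andbT /=; apply/hasPn => x xT.
  by apply: contraTN dST => xS; apply/fdisjointP => /(_ _ xS); rewrite xT.
- by move=> x; rewrite mem_cat in_fsetU.
Qed.

Lemma ninvUl S S' T :
  [disjoint S & S'] -> ninv (S `|` S') T = (ninv S T + ninv S' T)%N.
Proof. by move=> dS; rewrite /ninv sum_fsetU. Qed.
Lemma ninvUr S T T' :
  [disjoint T & T'] -> ninv S (T `|` T') = (ninv S T + ninv S T')%N.
Proof.
move=> dT; rewrite /ninv -big_split /=.
by apply: eq_bigr => s _; rewrite sum_fsetU.
Qed.

Lemma ssignA a b c :
  ssign a b * ssign (smul a b) c = ssign b c * ssign a (smul b c).
Proof.
rewrite /ssign /= fdisjointUX fdisjointXU.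
have [dab|] := boolP [disjoint a.2 & b.2]%fset; last by rewrite mul0r /= mulr0.
have [dbc|] := boolP [disjoint b.2 & c.2]%fset; last by rewrite andbF mulr0 mul0r.
rewrite andbT /=.
have [_|_] := boolP [disjoint a.2 & c.2]%fset; last by rewrite !mulr0.
by rewrite -!exprD ninvUl // ninvUr // addnA [in RHS]addnC.
Qed.

(* Free supercommutative algebra over L on even generators X and odd
   generators Y, as a monoid algebra twisted by [ssign]. *)
Definition superalg : Type := {malg L[smonom]}.
HB.instance Definition _ := GRing.Lmodule.on superalg.
Implicit Types f g h : superalg.

Definition sterm (c : L) (k : smonom) : superalg := << c *g k >>.

Definition smult f g : superalg :=
  \sum_(k <- msupp f) \sum_(l <- msupp g)
    sterm (f@_k * g@_l * ssign k l) (smul k l).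
Definition sunit : superalg := sterm 1 sone.

Let smultw (d e : {fset smonom}) f g : msupp f `<=` d -> msupp g `<=` e ->
  smult f g = \sum_(k <- d) \sum_(l <- e)
    sterm (f@_k * g@_l * ssign k l) (smul k l).
Proof.
move=> led lee; rewrite /smult (big_fset_incl _ led) /=.
  apply/eq_bigr=> k1 _; apply/big_fset_incl => // k _ /mcoeff_outdom ->.
  by rewrite mulr0 mul0r /sterm monalgU0.
move=> k _ /mcoeff_outdom fk.
by rewrite big1 // => k' _; rewrite fk !mul0r /sterm monalgU0.
Qed.

Let stermD k c d : sterm (c + d)%R k = (sterm c k + sterm d k)%R.
Proof. exact: monalgUD. Qed.

Let smultDl : left_distributive smult (@GRing.add superalg).
Proof.
move=> f g h; rewrite (smultw (msuppD_le f g) (fsubset_refl (msupp h))).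
rewrite (smultw (fsubsetUl _ (msupp g)) (fsubset_refl (msupp h))).
rewrite (smultw (fsubsetUr (msupp f) _) (fsubset_refl (msupp h))).
rewrite -big_split /=; apply/eq_bigr=> k1 _.
rewrite -big_split /=; apply/eq_bigr=> k2 _.
by rewrite mcoeffD !mulrDl stermD.
Qed.

Let smultDr : right_distributive smult (@GRing.add superalg).
Proof.
move=> h f g; rewrite (smultw (fsubset_refl (msupp h)) (msuppD_le f g)).
rewrite (smultw (fsubset_refl (msupp h)) (fsubsetUl _ (msupp g))).
rewrite (smultw (fsubset_refl (msupp h)) (fsubsetUr (msupp f) _)).
rewrite -big_split /=; apply/eq_bigr=> k1 _.
rewrite -big_split /=; apply/eq_bigr=> k2 _.
by rewrite mcoeffD mulrDr mulrDl stermD.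
Qed.

Let smult0l : left_zero 0 smult.
Proof. by move=> f; rewrite /smult msupp0 big_seq_fset0. Qed.
Let smult0r : right_zero 0 smult.
Proof. by move=> f; rewrite /smult big1 // => k _; rewrite msupp0 big_seq_fset0. Qed.

Let smultUU c k d l :
  smult (sterm c k) (sterm d l) = sterm (c * d * ssign k l) (smul k l).
Proof. by rewrite (smultw msuppU_le msuppU_le) !big_seq_fset1 !mcoeffUU. Qed.

Let stermE f : f = \sum_(k <- msupp f) sterm f@_k k.
Proof. exact: monalgE. Qed.

Let smult_suml (I : Type) (r : seq I) (F : I -> superalg) g :
  smult (\sum_(i <- r) F i) g = \sum_(i <- r) smult (F i) g.
Proof. exact: (big_morph (smult^~ g) (fun x y => smultDl x y g) (smult0l g)). Qed.
Let smult_sumr (I : Type) (r : seq I) (F : I -> superalg) g :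
  smult g (\sum_(i <- r) F i) = \sum_(i <- r) smult g (F i).
Proof. exact: (big_morph (smult g) (smultDr g) (smult0r g)). Qed.

Let smultA : associative smult.
Proof.
suff smult3 c a g h :
    smult (sterm c a) (smult g h) = smult (smult (sterm c a) g) h.
  move=> f g h; rewrite (stermE f) !smult_suml.
  by apply: eq_bigr => a _; exact: smult3.
rewrite (stermE g) smult_suml !smult_sumr smult_suml.
apply: eq_bigr => b _; rewrite (stermE h) !smult_sumr.
apply: eq_bigr => d _; rewrite !smultUU smulA; congr sterm.
rewrite -!mulrA; congr (_ * (_ * _)).
by rewrite [RHS]mulrCA ssignA mulrA.
Qed.

Let smult1 : left_id sunit smult.
Proof.
move=> f; rewrite [in LHS](stermE f) smult_sumr [RHS]stermE.
by apply: eq_bigr => k _; rewrite smultUU ssign1 mul1r mulr1 smul1.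
Qed.
Let smultr1 : right_id sunit smult.
Proof.
move=> f; rewrite [in LHS](stermE f) smult_suml [RHS]stermE.
by apply: eq_bigr => k _; rewrite smultUU ssignr1 !mulr1 smulr1.
Qed.
Let sunit_neq0 : sunit != 0.
Proof. by rewrite /sunit /sterm monalgU_eq0 oner_eq0. Qed.

HB.instance Definition _ := GRing.Zmodule_isNzRing.Build superalg
  smultA smult1 smultr1 smultDl smultDr sunit_neq0.

End Def.
End SuperAlgebra.

Import PowerSeries SuperAlgebra monalg.

(* Fields. Indices: [mu], [rho] spacetime, [m] local Lorentz frame, [a] gauge
   algebra, [al] spinor, [k] internal. Spacetime dimension [d], dimension [N] of
   the gauge algebra, [nH] real Higgs/Goldstone components, [nS] x [nI] fermion
   components (spinor x internal). *)
Section Fields.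
Variables d N nH nS nI : nat.

(* even fields other than the vielbein *)
Inductive bfield :=
| GaugeBoson of 'I_N & 'I_d          (* A^a_mu *)
| Higgs of 'I_nH                     (* Phi *)
| Fermion of bool & 'I_nS & 'I_nI    (* Psi; its complex conjugate if [true] *)
| LautrupB of 'I_d                   (* B^rho *)
| Lautrupb of 'I_N.                  (* b_a *)

Inductive gfield :=
| Ghost of 'I_d                      (* C_rho, lower index *)
| AntiGhost of 'I_d                  (* \bar C^rho, upper index *)
| GaugeGhost of 'I_N                 (* c^a *)
| GaugeAntiGhost of 'I_N.            (* \bar c_a *)

Inductive field :=
| Vielbein of 'I_d & 'I_d            (* e_mu^m *)
| Bos of bfield
| Gho of gfield.

Definition bfield_code (x : bfield) :
    'I_N * 'I_d + 'I_nH + bool * 'I_nS * 'I_nI + 'I_d + 'I_N :=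
  match x with
  | GaugeBoson a mu => inl (inl (inl (inl (a, mu))))
  | Higgs i => inl (inl (inl (inr i)))
  | Fermion b al k => inl (inl (inr (b, al, k)))
  | LautrupB rho => inl (inr rho)
  | Lautrupb a => inr a
  end.
Definition bfield_decode x : bfield :=
  match x with
  | inl (inl (inl (inl (a, mu)))) => GaugeBoson a mu
  | inl (inl (inl (inr i))) => Higgs i
  | inl (inl (inr (b, al, k))) => Fermion b al k
  | inl (inr rho) => LautrupB rho
  | inr a => Lautrupb a
  end.
Fact bfield_codeK : cancel bfield_code bfield_decode. Proof. by case. Qed.
HB.instance Definition _ := Countable.copy bfield (can_type bfield_codeK).

Definition gfield_code (x : gfield) : 'I_d + 'I_d + 'I_N + 'I_N :=
  match x with
  | Ghost rho => inl (inl (inl rho))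
  | AntiGhost rho => inl (inl (inr rho))
  | GaugeGhost a => inl (inr a)
  | GaugeAntiGhost a => inr a
  end.
Definition gfield_decode x : gfield :=
  match x with
  | inl (inl (inl rho)) => Ghost rho
  | inl (inl (inr rho)) => AntiGhost rho
  | inl (inr a) => GaugeGhost a
  | inr a => GaugeAntiGhost a
  end.
Fact gfield_codeK : cancel gfield_code gfield_decode. Proof. by case. Qed.
HB.instance Definition _ := Countable.copy gfield (can_type gfield_codeK).

(* (graviton-ghost degree, gauge ghost degree) *)
Definition gdeg (y : gfield) : int * int :=
  match y with
  | Ghost _ => (1, 0)
  | AntiGhost _ => (-1, 0)
  | GaugeGhost _ => (0, 1)
  | GaugeAntiGhost _ => (0, -1)
  end.

(* multi-indices of partial derivatives *)
Definition mindex := {ffun 'I_d -> nat}.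
HB.instance Definition _ := GRing.Nmodule.on mindex.
HB.instance Definition _ := Countable.on mindex.
Definition munit (mu : 'I_d) : mindex := [ffun nu => nat_of_bool (nu == mu)].

(* jet coordinates: the undifferentiated vielbein is not among them, it is
   carried by the power series variables *)
Definition xgen : Type :=
  ('I_d * 'I_d * {I : mindex | I != 0} + bfield * mindex)%type.
HB.instance Definition _ := Countable.on xgen.
Definition ygen : Type := (gfield * mindex)%type.
HB.instance Definition _ := Countable.on ygen.

Definition xjet (x : xgen) : field * mindex :=
  match x with
  | inl (mu, m, J) => (Vielbein mu m, val J)
  | inr (phi, J) => (Bos phi, J)
  end.
End Fields.

(* signature (- + ... +), so that - Det eta = 1 in every dimension *)
Definition minkowski (K : pzRingType) (d : nat) : 'M[K]_d :=
  \matrix_(m, n) if m != n then 0 else if m == 0%N :> nat then - 1 else 1.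

Record model (R : realType) := Model {
  dim : nat;
  dim_gt0 : (0 < dim)%N;
  gdim : nat;
  hdim : nat;
  sdim : nat;
  idim : nat;
  kappa : R;
  kappa_neq0 : kappa != 0;
  zeta : R;
  zeta_neq0 : zeta != 0;
  gamma : 'I_dim -> 'M[R[i]]_sdim;
  clifford : forall m n,
    gamma m *m gamma n + gamma n *m gamma m = (minkowski _ dim m n *+ 2)%:M;
  (* the connection of the twisting bundle is \sum_a A^a_rho * twist a; the
     coupling constant is part of [twist], and [twist = 0] is the untwisted
     spin connection *)
  twist : 'I_gdim -> 'M[R[i]]_idim
}.

Section Functionals.
Variables (R : realType) (M : model R).
Local Notation d := (dim M).
Local Notation K := R[i].
Local Notation mi := (mindex d).
Local Notation bfld := (bfield d (gdim M) (hdim M) (sdim M) (idim M)).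
Local Notation gfld := (gfield d (gdim M)).
Local Notation fld := (field d (gdim M) (hdim M) (sdim M) (idim M)).
Local Notation xg := (xgen d (gdim M) (hdim M) (sdim M) (idim M)).
Local Notation yg := (ygen d (gdim M)).
Local Notation L := (mps (d * d) K).

(* Local functionals at a point: superpolynomials in the jets of the fields
   whose coefficients are formal power series in the graviton, i.e. in the
   deviation e_mu^m - delta_mu^m of the vielbein. *)
Definition functional : Type := superalg L xg yg.
HB.instance Definition _ := GRing.NzRing.on functional.
Implicit Types f : functional.

Definition series (c : L) : functional := sterm c (sone _ _).
Definition cst (c : K) : functional := series (mpsC c).
Definition rcst (r : R) : functional := cst r%:C%C.

(* e_mu^m as a power series, with rows mu and columns m *)
Definition vielbein : 'M[L]_d :=
  \matrix_(mu, m) ((mu == m)%:R + mpsX K (mxvec_index mu m)).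

Definition jet (phi : fld) (I : mi) : functional :=
  match phi with
  | Vielbein mu m =>
      if insub I is Some J then sterm 1 (ucm (inl (mu, m, J)), fset0)
      else series (vielbein mu m)
  | Bos x => sterm 1 (ucm (inr (x, I)), fset0)
  | Gho y => sterm 1 (mone, [fset (y, I)]%fset)
  end.

(* The (even or odd) derivation sending each jet coordinate phi_I to v phi I,
   i.e. the sum over all coordinates of v phi I times the left partial
   derivative. *)
Definition superder (v : fld -> mi -> functional) f : functional :=
  \sum_(k <- msupp f)
    (\sum_mu \sum_m v (Vielbein _ _ _ _ mu m) 0 *
        sterm (mps_deriv (mxvec_index mu m) f@_k) k
     + \sum_(x <- finsupp k.1) v (xjet x).1 (xjet x).2 *
        sterm (f@_k *+ k.1 x) (divcm k.1 (ucm x), k.2)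
     + \sum_(y <- k.2) v (Gho _ _ _ y.1) y.2 *
        sterm ((-1) ^+ ninv [fset y]%fset k.2 * f@_k)
              (k.1, (k.2 `\ y)%fset)).

(* total derivative *)
Definition tder (mu : 'I_d) : functional -> functional :=
  superder (fun phi I => jet phi (I + munit mu)).

Definition iterD (T : Type) (D : 'I_d -> T -> T) (I : mi) (x : T) : T :=
  foldr (fun mu => iter (I mu) (D mu)) x (enum 'I_d).

(* the derivation commuting with all total derivatives and acting on the
   fields by v *)
Definition evolutionary (v : fld -> functional) : functional -> functional :=
  superder (fun phi I => iterD tder I (v phi)).

Definition eqTD f1 f2 : Prop :=
  exists J : 'I_d -> functional, f1 - f2 = \sum_mu tder mu (J mu).

Definition fld0 (phi : fld) : functional := jet phi 0.
Local Notation Aa a mu := (fld0 (Bos (GaugeBoson _ _ _ a mu))).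
Local Notation PhiH i := (fld0 (Bos (Higgs _ _ _ _ i))).
Local Notation PsiF b al k := (fld0 (Bos (Fermion _ _ _ b al k))).
Local Notation BN rho := (fld0 (Bos (LautrupB _ _ _ _ rho))).
Local Notation Cl rho := (fld0 (Gho _ _ _ (Ghost _ rho))).
Local Notation Cb rho := (fld0 (Gho _ _ _ (AntiGhost _ rho))).

Definition eta (m n : 'I_d) : K := minkowski K d m n.
Definition metricM : 'M[L]_d :=
  vielbein *m (minkowski L d) *m vielbein^T.
Definition gl (mu nu : 'I_d) : functional := series (metricM mu nu).
Definition gu (mu nu : 'I_d) : functional :=
  series (\adj metricM mu nu * - mps_pow (- \det metricM) (-1)).

(* (- Det g)^(w/2) *)
Definition density (w : R) : functional :=
  series (mps_pow (- \det metricM) (w / 2)%:C%C).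

(* inverse vielbein e^(mu m), frame index raised with eta *)
Definition eu (mu m : 'I_d) : functional :=
  \sum_n cst (eta m n) *
    series (\adj vielbein n mu * mps_pow (\det vielbein) (-1)).

(* h, from g = eta + kappa h *)
Definition graviton (mu nu : 'I_d) : functional :=
  rcst (kappa M)^-1 * (gl mu nu - cst (eta mu nu)).

Definition Christoffel (rho mu nu : 'I_d) : functional :=
  rcst 2^-1 * \sum_sg gu rho sg *
    (tder mu (gl sg nu) + tder nu (gl sg mu) - tder sg (gl mu nu)).

(* omega_rho^(m n) = e_nu^m nabla_rho e^(nu n) *)
Definition spinconn (rho m n : 'I_d) : functional :=
  \sum_nu fld0 (Vielbein _ _ _ _ nu m) *
    (tder rho (eu nu n) + \sum_sg Christoffel nu rho sg * eu sg n).

(* Normalized so that i * sigma_mn = [gamma_m, gamma_n] / 4 are the Lorentz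
   generators in the spin representation; this is the normalization for which
   the formula for P Psi, with coefficient i / 4, is Kosmann's. *)
Definition sigma (m n : 'I_d) : 'M[K]_(sdim M) :=
  (- 'i%C / 4) *: (gamma m *m gamma n - gamma n *m gamma m).

Definition cj (b : bool) (z : K) : K := if b then (z^*)%C else z.

Definition spincov (rho : 'I_d) (b : bool) (al : 'I_(sdim M)) (k : 'I_(idim M))
    : functional :=
  tder rho (PsiF b al k)
  + \sum_m \sum_n \sum_be spinconn rho m n
      * cst (cj b ('i%C / 2 * sigma m n al be)) * PsiF b be k
  + \sum_a \sum_l Aa a rho * cst (cj b (twist a k l)) * PsiF b al l.

(* Lie derivatives along the vector field X, where dX mu rho stands for
   the partial derivative of X^rho with respect to x^mu *)
Section Lie.
Variables (X : 'I_d -> functional) (dX : 'I_d -> 'I_d -> functional).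

Definition transport f : functional := \sum_rho X rho * tder rho f.

Definition lie_metric (mu nu : 'I_d) : functional :=
  transport (gl mu nu) +
  \sum_rho (dX mu rho * gl rho nu + dX nu rho * gl mu rho).

(* d_mu X_nu *)
Definition dXl (mu nu : 'I_d) : functional :=
  \sum_sg (X sg * tder mu (gl nu sg) + dX mu sg * gl nu sg).

(* On frames and spinors this is Kosmann's Lie derivative: on the vielbein it
   is the tensorial one plus a local Lorentz rotation, which gives half of the
   Lie derivative of the metric. *)
Definition lie (phi : fld) : functional :=
  match phi with
  | Vielbein mu m => rcst 2^-1 * \sum_nu lie_metric mu nu * eu nu m
  | Bos (GaugeBoson a mu) =>
      transport (fld0 phi) + \sum_rho dX mu rho * Aa a rho
  | Bos (Higgs _) => transport (fld0 phi)
  | Bos (Fermion b al k) =>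
      \sum_rho X rho * spincov rho b al k +
      \sum_mu \sum_nu \sum_m \sum_n \sum_be
        (dXl mu nu - dXl nu mu) * eu mu m * eu nu n
        * cst (cj b ('i%C / 4 * sigma m n al be)) * PsiF b be k
  | Bos (LautrupB rho) => transport (fld0 phi) - \sum_sg dX sg rho * BN sg
  | Bos (Lautrupb _) => transport (fld0 phi)
  | Gho (Ghost rho) => transport (fld0 phi) + \sum_sg dX rho sg * Cl sg
  | Gho (AntiGhost rho) => transport (fld0 phi) - \sum_sg dX sg rho * Cb sg
  | Gho (GaugeGhost _) => transport (fld0 phi)
  | Gho (GaugeAntiGhost _) => transport (fld0 phi)
  end.
End Lie.

(* Infinitesimal diffeomorphism, given by the jet at a point of an arbitrary
   real vector field: xi rho I is the I-th partial derivative of its rho-th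
   component. An expression depending on xi is differentiated by the chain
   rule, both in the fields and in xi. *)
Definition vecjet := 'I_d -> mi -> R.

Definition xtder (mu : 'I_d) (F : vecjet -> functional) (xi : vecjet) :
    functional :=
  tder mu (F xi) + F (fun rho I => xi rho (I + munit mu)).

Definition lie_xi (phi : fld) (xi : vecjet) : functional :=
  lie (fun rho => rcst (xi rho 0)) (fun mu rho => rcst (xi rho (munit mu))) phi.

Definition diffeo (xi : vecjet) : functional -> functional :=
  superder (fun phi I => iterD xtder I (lie_xi phi) xi).

(* f is a scalar (tensor density of weight 0) *)
Definition covariant f : Prop :=
  forall xi : vecjet, diffeo xi f = \sum_rho rcst (xi rho 0) * tder rho f.

Definition bidegree (i j : int) f : Prop :=
  forall k, k \in msupp f -> \sum_(y <- k.2) gdeg y.1 = (i, j).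

(* tensor density of weight w and bidegree (i, j) *)
Definition CQ (w : R) (i j : int) f : Prop :=
  exists f0, [/\ covariant f0, bidegree i j f0 & f = density w * f0].

Definition constant_functional f : Prop := exists c : K, f = cst c.

Definition involves_even (phi : bfld) f : Prop :=
  exists I k, k \in msupp f /\ inr (phi, I) \in finsupp k.1.
Definition involves_odd (phi : gfld) f : Prop :=
  exists I k, k \in msupp f /\ (phi, I) \in k.2.

Definition involves_C f := exists rho, involves_odd (Ghost _ rho) f.
Definition involves_Cbar f := exists rho, involves_odd (AntiGhost _ rho) f.
Definition involves_B f := exists rho, involves_even (LautrupB _ _ _ _ rho) f.

(* C^rho, \bar C_rho, B_rho *)
Definition Cu (rho : 'I_d) : functional := \sum_sg gu rho sg * Cl sg.
Definition Cbl (rho : 'I_d) : functional := \sum_sg gl rho sg * Cb sg.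
Definition Bl (rho : 'I_d) : functional := \sum_sg gl rho sg * BN sg.

(* P h_(mu nu), as a function of the ghost with lower index *)
Definition Pgraviton (c : 'I_d -> functional) (mu nu : 'I_d) : functional :=
  rcst (zeta M)^-1 * tder mu (c nu) + rcst (zeta M)^-1 * tder nu (c mu)
  - rcst 2 * \sum_rho c rho * Christoffel rho mu nu.

(* the variation of the vielbein, free of local Lorentz rotation, that
   induces the variation dh of h *)
Definition dvielbein (dh : 'I_d -> 'I_d -> functional) (mu m : 'I_d) :
    functional :=
  rcst (kappa M / 2) * \sum_nu dh mu nu * eu nu m.

Definition P_field (phi : fld) : functional :=
  match phi with
  | Vielbein mu m => dvielbein (Pgraviton (fun rho => Cl rho)) mu m
  | Gho (Ghost rho) => rcst (kappa M) * \sum_sg Cu sg * tder sg (Cl rho)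
  | Gho (AntiGhost rho) => rcst (zeta M)^-1 * BN rho
  | Bos (LautrupB _) => 0
  | _ => rcst (kappa M) * lie Cu (fun mu rho => tder mu (Cu rho)) phi
  end.

Definition Pbar_field (phi : fld) : functional :=
  match phi with
  | Vielbein mu m => dvielbein (Pgraviton Cbl) mu m
  | Gho (Ghost rho) =>
      - (rcst (zeta M)^-1 * Bl rho)
      + rcst (kappa M) * (\sum_sg Cb sg * tder sg (Cl rho))
      + rcst (kappa M) * (\sum_sg tder rho (Cb sg) * Cl sg)
  | Gho (AntiGhost rho) => rcst (kappa M) * \sum_sg Cb sg * tder sg (Cb rho)
  | Bos (LautrupB rho) =>
      rcst (kappa M) * (\sum_sg Cb sg * tder sg (BN rho))
      - rcst (kappa M) * (\sum_sg tder sg (Cb rho) * BN sg)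
  | _ => rcst (kappa M) *
         lie (fun rho => Cb rho) (fun mu rho => tder mu (Cb rho)) phi
  end.

Definition BRST : functional -> functional := evolutionary P_field.
Definition antiBRST : functional -> functional := evolutionary Pbar_field.
End Functionals.

(* Main.v *)
(* Write C for the ghost vector field and D_(rho, I) for the coefficient of the jet
   coordinate d_I xi^rho in the infinitesimal diffeomorphism. Covariance of f0 for
   all real vector fields gives D_(rho, I) f0 = 0 for I <> 0 and D_(rho, 0) f0 =
   d_rho f0, so real xi may be replaced by the odd C, and f0 is transported by P as
   kappa C^rho d_rho f0. Since (- Det g)^(w/2) acquires in addition w times the
   divergence of C, a density f = (- Det g)^(w/2) f0 satisfies
     P f = kappa d_rho (C^rho f) + kappa (w - 1) (d_rho C^rho) f.
   This is a total derivative if w = 1. If it is one for some other w, then so is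
   C^rho d_rho f, which is linear in an undifferentiated ghost; the Euler operator
   of that ghost kills total derivatives and returns d_rho f = 0, and a functional
   whose total derivatives vanish is constant. The same computation applied to
   diffeomorphisms of unit divergence shows that the weight of a nonzero density is
   unique. *)
From HB Require Import structures.
Require Import Defs.
From mathcomp Require Import all_boot all_order all_algebra.
From mathcomp Require Import finmap.
From mathcomp.multinomials Require mpoly monalg.
From mathcomp.real_closed Require Import complex.
From mathcomp Require Import boolp reals.
From mathcomp Require Import perm ring.

Set Implicit Arguments.
Unset Strict Implicit.
Unset Printing Implicit Defensive.
Import Order.TTheory GRing.Theory Num.Theory.
Local Open Scope ring_scope.

(** * Formal power series *)

(** The argument works because [P] and [\bar P] act on every field that [f] may involve as kappa
    times a Lie derivative. On the vielbein this rests on [zeta1]: with 1/zeta = 1 the derivative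
    terms of P h and the Christoffel term combine into the Lie derivative of the metric. For [P] the
    field B^rho has to be excluded, since P B = 0, whereas [\bar P] transports B^rho by the Lie
    derivative along \bar C.

    Both operators are instances of one statement about a vector field c^rho = Q^(rho sg) phi_sg
    with odd fields phi_sg and an invertible matrix [Q]: the inverse metric for C_sg, whose index is
    lower, and the identity for \bar C^sg.

    The obstacle in passing from real vector fields to c is that c is odd. Every expression is
    therefore arranged with the jet of the vector field leftmost; what stands to its right is one
    finite list of coefficients, which serves real jets and functionals alike, and no sign ever
    arises.

    The undifferentiated vielbein sits in power series, so powers of - Det g are binomial series
    around the flat background. Their exponent is w/2, which is why the weight appears as
    [a + a]. *)

Module PowerSeriesTheory.
Import mpoly PowerSeries.

Section Ring.
Variables (n : nat) (K : comNzRingType).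
Implicit Types f g h : mps n K.

(** A coefficient of a product of series depends on finitely many coefficients of the factors, so
    identities are checked on truncations, where the theory of [{mpoly K[n]}] applies. *)
Definition mpstrunc N f : {mpoly K[n]} := \sum_(m : 'X_{1..n < N}) f m *: 'X_[m].

Lemma mpstruncE N f m : (mdeg m < N)%N -> (mpstrunc N f)@_m = f m.
Proof. exact: mcoeff_mpoly. Qed.

Lemma mpsD f g m : (f + g) m = f m + g m. Proof. by []. Qed.
Lemma mpsN f m : (- f) m = - f m. Proof. by []. Qed.
Lemma mps0E m : (0 : mps n K) m = 0. Proof. by []. Qed.
Lemma mps1E m : (1 : mps n K) m = (m == 0%MM)%:R. Proof. by []. Qed.
Lemma mps_sumE I (r : seq I) P (F : I -> mps n K) m :
  (\sum_(i <- r | P i) F i) m = \sum_(i <- r | P i) F i m.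
Proof. by elim/big_rec2: _ => // i x y _ <-. Qed.

Lemma mpsM_trunc N f g m : (mdeg m < N)%N ->
  (f * g) m = (mpstrunc N f * mpstrunc N g)@_m.
Proof.
move=> ltmN; rewrite (@mcoeff_poly_mul_lin _ _ _ _ m (mdeg m).+1) //.
apply: eq_bigr => k lekm; have ltk : (mdeg k <= mdeg m)%N by rewrite -ltnS bmdeg.
rewrite !mpstruncE //; last exact: leq_ltn_trans ltk ltmN.
exact: leq_ltn_trans (mdegB _ _) ltmN.
Qed.

Lemma eq_mpsM f g f' g' m :
    (forall k, (mdeg k <= mdeg m)%N -> f k = f' k) ->
    (forall k, (mdeg k <= mdeg m)%N -> g k = g' k) ->
  (f * g) m = (f' * g') m.
Proof.
move=> ff gg; apply: eq_bigr => k _; rewrite ff ?gg ?mdegB //.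
by rewrite -ltnS bmdeg.
Qed.

Lemma mpsM_eq0 a b f g m :
    (forall k, (mdeg k < a)%N -> f k = 0) -> (forall k, (mdeg k < b)%N -> g k = 0) ->
  (mdeg m < a + b)%N -> (f * g) m = 0.
Proof.
move=> fa gb ltm; apply: big1 => k lekm.
have [/fa ->|lek] := ltnP (mdeg k) a; first by rewrite mul0r.
rewrite gb ?mulr0 //.
have : mdeg (m - k + k)%MM = mdeg m by rewrite submK.
rewrite mdegD => E; rewrite -(ltn_add2r (mdeg k)) E.
by apply: leq_trans ltm _; rewrite addnC leq_add2l.
Qed.

Lemma mpsCE (c : K) m : (mpsC c : mps n K) m = c *+ (m == 0%MM). Proof. by []. Qed.

Lemma mpsCM (c : K) f m : (mpsC c * f) m = c * f m.
Proof.
rewrite (@mpsM_trunc (mdeg m).+1) //.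
transitivity (((c%:MP) * mpstrunc (mdeg m).+1 f)@_m); last first.
  by rewrite mcoeffCM mpstruncE.
rewrite !(@mcoeff_poly_mul_lin _ _ _ _ m (mdeg m).+1) //.
apply: eq_bigr => k _; rewrite mpstruncE ?bmdeg // mcoeffC mpsCE.
by rewrite mulr_natr.
Qed.

Lemma mpsC_is_zmod_morphism : zmod_morphism (@mpsC n K).
Proof. by move=> a b; apply/funext => m; rewrite mpsD mpsN !mpsCE mulrnBl. Qed.
Lemma mpsC_is_monoid_morphism : monoid_morphism (@mpsC n K).
Proof.
split=> [|a b]; first by [].
by apply/funext => m; rewrite mpsCM !mpsCE mulrnAr.
Qed.
HB.instance Definition _ := GRing.isZmodMorphism.Build K (mps n K) (@mpsC n K)
  mpsC_is_zmod_morphism.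
HB.instance Definition _ := GRing.isMonoidMorphism.Build K (mps n K) (@mpsC n K)
  mpsC_is_monoid_morphism.

Definition mps_const f : K := f 0%MM.

Lemma mps_const_is_zmod_morphism : zmod_morphism mps_const.
Proof. by []. Qed.
Lemma mps_const_is_monoid_morphism : monoid_morphism mps_const.
Proof.
split=> [|f g]; first by rewrite /mps_const mps1E eqxx.
rewrite /mps_const (@mpsM_trunc 1) ?mdeg0 // (rmorphM (mcoeff 0%MM)) /=.
by rewrite !mpstruncE ?mdeg0.
Qed.
HB.instance Definition _ := GRing.isZmodMorphism.Build (mps n K) K mps_const
  mps_const_is_zmod_morphism.
HB.instance Definition _ := GRing.isMonoidMorphism.Build (mps n K) K mps_const
  mps_const_is_monoid_morphism.

Lemma mps_constX i : mps_const (mpsX K i) = 0.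
Proof.
rewrite /mps_const /mpsX; case: eqP => // /(congr1 mdeg).
by rewrite mdeg0 mdeg1.
Qed.

Lemma mps_deriv_is_zmod_morphism (i : 'I_n) :
  zmod_morphism (@mps_deriv n K i : mps n K -> mps n K).
Proof.
by move=> f g; apply/funext => m; rewrite /mps_deriv mpsD mpsN mulrnBl.
Qed.
HB.instance Definition _ i := GRing.isZmodMorphism.Build (mps n K) (mps n K)
  (@mps_deriv n K i) (mps_deriv_is_zmod_morphism i).

Lemma mcoeff_deriv_trunc N i f m : (mdeg m < N)%N ->
  (mpstrunc N.+1 f)^`M(i)@_m = mps_deriv i f m.
Proof.
move=> ltm; rewrite mcoeff_deriv mpstruncE ?mdegD ?mdeg1 ?addn1 //.
Qed.

Lemma mps_derivM i f g :
  mps_deriv i (f * g) = mps_deriv i f * g + f * mps_deriv i g.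
Proof.
apply/funext => m; pose N := (mdeg m).+1.
have ltU : (mdeg (m + U_(i))%MM < N.+1)%N by rewrite mdegD mdeg1 addn1.
rewrite /mps_deriv (@mpsM_trunc N.+1) // -mcoeff_deriv mderivM mcoeffD mpsD.
congr (_ + _); rewrite (@mpsM_trunc N) //.
  rewrite !(@mcoeff_poly_mul_lin _ _ _ _ m N) //.
  apply: eq_bigr => k _; rewrite mcoeff_deriv_trunc ?bmdeg // !mpstruncE ?bmdeg //.
    by rewrite ltnS mdegB.
  by rewrite !ltnS (leq_trans (mdegB _ _)).
rewrite !(@mcoeff_poly_mul_lin _ _ _ _ m N) //.
apply: eq_bigr => k _; rewrite mcoeff_deriv_trunc ?ltnS ?mdegB // !mpstruncE ?bmdeg //.
  by rewrite ltnS mdegB.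
by rewrite ltnS ltnW ?bmdeg.
Qed.

Lemma mps_derivC i (c : K) : mps_deriv i (mpsC c : mps n K) = 0.
Proof.
apply/funext => m; rewrite /mps_deriv mpsCE; case: eqP => [/(congr1 mdeg)|_].
  by rewrite mdegD mdeg1 mdeg0 addn1.
by rewrite mulr0n mul0rn.
Qed.

Lemma mps_deriv1 i : mps_deriv i 1 = 0 :> mps n K.
Proof. exact: mps_derivC. Qed.

Lemma mps_derivX i j : mps_deriv i (mpsX K j) = (i == j)%:R :> mps n K.
Proof.
apply/funext => m; rewrite /mps_deriv /mpsX.
have -> : (i == j)%:R = (mpsC ((i == j)%:R : K) : mps n K) by rewrite rmorph_nat.
rewrite mpsCE; case: (eqVneq (m + U_(i))%MM U_(j)%MM) => [E|E].
  have m0 : m = 0%MM.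
    apply/eqP; rewrite -mdeg_eq0; move/(congr1 mdeg): E.
    by rewrite mdegD !mdeg1 => /eqP; rewrite -{2}[1%N]add0n eqn_add2r.
  have ij : i = j.
    by move: E; rewrite m0 add0m => /eqP; rewrite eq_mnm1 => /eqP.
  by rewrite m0 ij !eqxx mnm0E.
rewrite mul0rn; case: (eqVneq m 0%MM) E => [->|]; last by rewrite mulr0n.
by rewrite add0m eq_mnm1 => /negbTE ->.
Qed.

Lemma mps_deriv_comm i j f : mps_deriv i (mps_deriv j f) = mps_deriv j (mps_deriv i f).
Proof.
apply/funext => m; rewrite /mps_deriv -!mulrnA -!addmA [(U_(i) + _)%MM]addmC.
congr (_ *+ _); rewrite !mnmDE !mnmE [(j == i)]eq_sym; case: eqP => [->//|_].
by rewrite !addn0 mulnC.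
Qed.
End Ring.

Lemma mps_deriv_eq0 n (K : numDomainType) (f : mps n K) :
  (forall i, mps_deriv i f = 0) -> exists c, f = mpsC c.
Proof.
move=> f0; exists (f 0%MM); apply/funext => m; rewrite mpsCE; case: eqVneq => [->//|m0].
have [i mi] : exists i, m i != 0%N.
  apply/existsP; apply: contraNT m0; rewrite negb_exists => /forallP h.
  by apply/eqP/mnmP => i; rewrite mnm0E; apply/eqP; have := h i; rewrite negbK.
have /(congr1 (fun g : mps n K => g (m - U_(i))%MM))/eqP := f0 i.
rewrite /mps_deriv submK ?mps0E; last first.
  by apply/mnm_lepP => j; rewrite mnm1E; case: eqP => // <-; rewrite lt0n.
by rewrite mulrn_eq0 /= => /eqP ->.
Qed.

(** * Binomial powers of a series with constant coefficient 1 *)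

Section Pow.
Variables (n : nat) (K : numFieldType).
Implicit Types (a b : K) (p q : {poly K}) (u F : mps n K).

Let nat1_neq0 k : k.+1%:R != 0 :> K. Proof. by rewrite pnatr_eq0. Qed.

Lemma gbin0 a : gbin a 0 = 1.
Proof. by rewrite /gbin big_ord0 fact0 divr1. Qed.

Lemma gbin_recr a k : k.+1%:R * gbin a k.+1 = (a - k%:R) * gbin a k.
Proof.
have kN0 : k`!%:R != 0 :> K by rewrite pnatr_eq0 -lt0n fact_gt0.
rewrite /gbin big_ord_recr /= factS natrM.
by move: (nat1_neq0 k) => k1; field; rewrite kN0 -natr1 addrC in k1 *.
Qed.

Lemma gbin_recl a k : k.+1%:R * gbin a k.+1 = a * gbin (a - 1) k.
Proof.
have kN0 : k`!%:R != 0 :> K by rewrite pnatr_eq0 -lt0n fact_gt0.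
rewrite /gbin big_ord_recl /= subr0 factS natrM.
rewrite (eq_bigr (fun j : 'I_k => a - 1 - j%:R)); last first.
  by move=> j _; rewrite /bump /= natrD opprD addrA.
by move: (nat1_neq0 k) => k1; field; rewrite kN0 -natr1 addrC in k1 *.
Qed.

(** Vandermonde's identity by induction: after multiplication by [k.+1], this factor is split as
    [j + (k.+1 - j)], each summand is absorbed by [gbin_recr], and the two resulting factors add up
    to [a + b - k]. *)
Lemma gbin_vandermonde a b k :
  \sum_(j < k.+1) gbin a j * gbin b (k - j) = gbin (a + b) k.
Proof.
elim: k => [|k IH]; first by rewrite big_ord1 !gbin0 mulr1.
apply: (mulfI (nat1_neq0 k)); rewrite gbin_recr -IH !mulr_sumr.
transitivity (\sum_(j < k.+2) (j%:R * gbin a j * gbin b (k.+1 - j)) +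
              \sum_(j < k.+2) (gbin a j * ((k.+1 - j)%:R * gbin b (k.+1 - j)))).
  rewrite -big_split /=; apply: eq_bigr => j _.
  rewrite -{1}(subnKC (leq_ord j)) natrD; ring.
rewrite big_ord_recl /= !mul0r add0r [X in _ + X]big_ord_recr /= subnn !mul0r mulr0 addr0.
rewrite -big_split /=; apply: eq_bigr => j _.
rewrite /bump /= add1n subSS gbin_recr (subSn (leq_ord j)) gbin_recr.
by rewrite (natrB _ (leq_ord j)); ring.
Qed.

(** If [u] has no constant coefficient, [u ^+ k] starts in degree [k]. Up to a given degree a
    binomial series in [u] is thus a polynomial in [u], and identities between such series become
    identities of polynomials modulo a power of ['X]. *)
Definition mps_horner u p : mps n K := (map_poly (@mpsC n K) p).[u].

Lemma mps_hornerM u p q : mps_horner u (p * q) = mps_horner u p * mps_horner u q.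
Proof. by rewrite /mps_horner rmorphM hornerM. Qed.
Lemma mps_hornerB u p q : mps_horner u (p - q) = mps_horner u p - mps_horner u q.
Proof. by rewrite /mps_horner rmorphB hornerD hornerN. Qed.
Lemma mps_hornerZ u a p : mps_horner u (a *: p) = mpsC a * mps_horner u p.
Proof. by rewrite /mps_horner map_polyZ hornerZ. Qed.

Lemma mpsXn_eq0 u k m : u 0%MM = 0 -> (mdeg m < k)%N -> (u ^+ k) m = 0.
Proof.
move=> u0; elim: k m => // k IH m ltm; rewrite exprS.
apply: (@mpsM_eq0 _ _ 1%N k) => // l; rewrite ltnS leqn0 mdeg_eq0 => /eqP ->.
exact: u0.
Qed.

Lemma mps_horner_eq0 u N p m : u 0%MM = 0 -> (forall i, (i < N)%N -> p`_i = 0) ->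
  (mdeg m < N)%N -> mps_horner u p m = 0.
Proof.
move=> u0 p0 ltm; rewrite /mps_horner horner_coef mps_sumE big1 // => i _.
rewrite coef_map mpsCM; have [/p0 ->|leN] := ltnP i N; first by rewrite mul0r.
by rewrite mpsXn_eq0 ?mulr0 // (leq_trans ltm).
Qed.

Lemma mps_deriv_horner i u p :
  mps_deriv i (mps_horner u p) = mps_horner u p^`() * mps_deriv i u.
Proof.
rewrite /mps_horner; elim/poly_ind: p => [|p c IH].
  by rewrite deriv0 rmorph0 !horner0 mul0r raddf0.
rewrite derivD derivM derivX mulr1 derivC addr0.
rewrite !rmorphD !rmorphM /= map_polyX map_polyC /= !hornerE raddfD /= mps_derivC addr0.
by rewrite mps_derivM IH /=; ring.
Qed.

Definition gbin_poly N a : {poly K} := \poly_(k < N) gbin a k.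

Lemma gbin_polyE N a F m : (F - 1) 0%MM = 0 -> (mdeg m < N)%N ->
  mps_pow F a m = mps_horner (F - 1) (gbin_poly N a) m.
Proof.
move=> F0 ltm; rewrite /gbin_poly poly_def /mps_horner raddf_sum horner_sum mps_sumE.
rewrite /mps_pow (big_ord_widen N (fun k => gbin a k * ((F - 1) ^+ k) m)) // big_mkcond /=.
apply: eq_bigr => k _; rewrite map_polyZ map_polyXn hornerZ hornerXn mpsCM.
by case: ltnP => // lek; rewrite mpsXn_eq0 ?mulr0.
Qed.

Lemma mps_pow0 F : mps_pow F 0 = 1.
Proof.
apply/funext => m; rewrite /mps_pow big_ord_recl /= gbin0 mul1r expr0 big1 ?addr0 //.
by move=> i _; rewrite /gbin big_ord_recl subr0 !mul0r.
Qed.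

Section Unipotent.
Variable F : mps n K.
Hypothesis F1 : mps_const F = 1.

Let F0 : (F - 1) 0%MM = 0.
Proof. by rewrite mpsD mpsN [F _]F1 mps1E eqxx subrr. Qed.

Lemma mps_pow1 : mps_pow F 1 = F.
Proof.
(* Degree 0 is treated apart: there the polynomial truncated at [(mdeg m).+1] would lose its linear
   term. *)
apply/funext => m; case: (posnP (mdeg m)) => [/eqP|m_gt0].
  rewrite mdeg_eq0 => /eqP ->; rewrite /mps_pow mdeg0 big_ord1 gbin0 mul1r expr0.
  by rewrite [F _]F1 mps1E eqxx.
rewrite (@gbin_polyE (mdeg m).+1) //; set p := gbin_poly _ _.
have -> : p = 1 + 'X.
  apply/polyP => k; rewrite coef_poly coefD coef1 coefX ltnS.
  case: k => [|[|k]]; rewrite ?leq0n ?gbin0 ?addr0 ?add0r //.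
    by rewrite m_gt0; apply: (mulfI (nat1_neq0 0)); rewrite gbin_recr gbin0 subr0.
  by rewrite /gbin 2!big_ord_recl /= subrr mul0r mulr0 mul0r if_same ?addr0.
by rewrite /mps_horner rmorphD rmorph1 /= map_polyX hornerD hornerX -polyC1 hornerC addrC subrK.
Qed.

(** By Vandermonde's identity the product of the two truncated binomial polynomials has the right
    coefficients below [N]; the discrepancy starts at ['X^N] and does not reach [m]. *)
Lemma mps_powD a b : mps_pow F (a + b) = mps_pow F a * mps_pow F b.
Proof.
apply/funext => m; pose N := (mdeg m).+1.
rewrite (@gbin_polyE N) //.
transitivity (mps_horner (F - 1) (gbin_poly N a * gbin_poly N b) m); last first.
  rewrite mps_hornerM; apply: eq_mpsM => k lek; rewrite (@gbin_polyE N) //.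
apply/eqP; rewrite -subr_eq0 -mpsN -mpsD -mps_hornerB; apply/eqP.
apply: (@mps_horner_eq0 _ N) => // k ltk.
rewrite coefB coefM coef_poly ltk -gbin_vandermonde.
apply/eqP; rewrite subr_eq0; apply/eqP; apply: eq_bigr => j _.
by rewrite !coef_poly (leq_ltn_trans (leq_ord j) ltk) (leq_ltn_trans (leq_subr _ _) ltk).
Qed.

Lemma mps_deriv_pow i a :
  mps_deriv i (mps_pow F a) = mpsC a * mps_pow F (a - 1) * mps_deriv i F.
Proof.
apply/funext => m; pose N := (mdeg m).+1.
transitivity (mps_deriv i (mps_horner (F - 1) (gbin_poly N.+1 a)) m).
  by rewrite /mps_deriv (@gbin_polyE N.+1) // mdegD mdeg1 addn1.
rewrite mps_deriv_horner raddfB /= mps_deriv1 subr0.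
have -> : (gbin_poly N.+1 a)^`() = a *: gbin_poly N (a - 1).
  apply/polyP => k; rewrite coef_deriv coefZ !coef_poly ltnS.
  by case: ifP => _; rewrite ?mul0rn ?mulr0 // -mulr_natl gbin_recl.
rewrite mps_hornerZ; apply: eq_mpsM => // k lek.
by rewrite !mpsCM (@gbin_polyE N).
Qed.

Lemma mps_powN1 : mps_pow F (-1) * F = 1.
Proof. by rewrite -{2}mps_pow1 -mps_powD addNr mps_pow0. Qed.
End Unipotent.
End Pow.

(** Jacobi's formula: a derivation of the Leibniz expansion differentiates one row at a time. *)
Lemma derivation_det (A : comNzRingType) (D : A -> A) k (M : 'M[A]_k) :
  {morph D : x y / x + y} ->
  (forall x y, D (x * y) = D x * y + x * D y) ->
  D (\det M) = \sum_i \sum_j D (M i j) * (\adj M) j i.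
Proof.
move=> DD DM; have D1 : D 1 = 0.
  by have := DM 1 1; rewrite !(mulr1, mul1r) -{1}[D 1]addr0 => /addrI.
have D0 : D 0 = 0 by apply: (@addrI _ (D 0)); rewrite -DD !addr0.
have DN x : D (- x) = - D x by apply: (@addrI _ (D x)); rewrite -DD !subrr.
have Dsgn (b : bool) x : D ((-1) ^+ b * x) = (-1) ^+ b * D x.
  by case: b; rewrite ?expr0 ?expr1 ?mul1r // !mulN1r DN.
have Dprod (s : {perm 'I_k}) : D (\prod_i M i (s i)) =
    \sum_i D (M i (s i)) * \prod_(j | j != i) M j (s j).
  suff gen (r : seq 'I_k) (F : 'I_k -> A) : uniq r ->
      D (\prod_(i <- r) F i) = \sum_(i <- r) D (F i) * \prod_(j <- r | j != i) F j.
    by rewrite gen ?index_enum_uniq.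
  elim: r => [|i r IH] /=; first by rewrite !big_nil D1.
  case/andP=> inr ur; rewrite !big_cons DM IH // eqxx /=; congr (_ * _ + _).
    rewrite big_seq_cond [RHS]big_seq_cond; apply: eq_bigl => j.
    by case: (boolP (j \in r)) => //= jr; case: eqP jr inr => // -> ->.
  rewrite mulr_sumr big_seq [RHS]big_seq; apply: eq_bigr => j jr.
  rewrite big_cons; case: eqP jr inr => [-> -> //|_ _ _]; exact: mulrCA.
rewrite (big_morph D DD D0) /=; under eq_bigr do rewrite Dsgn Dprod mulr_sumr.
rewrite exchange_big; apply: eq_bigr => i _ /=.
(* [N] is [M] with row [i] differentiated; its cofactors along that row are those of [M]. *)
pose N := \matrix_(i', j) (if i' == i then D (M i j) else M i' j).
transitivity (\det N).
  apply: eq_bigr => s _; rewrite [in RHS](bigD1 i) //= [N i _]mxE eqxx; congr (_ * (_ * _)).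
  by apply: eq_bigr => j /negbTE ji; rewrite [N j _]mxE ji.
rewrite (expand_det_row _ i); apply: eq_bigr => j _; rewrite !mxE eqxx; congr (_ * (_ * \det _)).
by apply/matrixP => a b; rewrite !mxE eq_sym (negbTE (neq_lift _ _)).
Qed.
End PowerSeriesTheory.

(** * Superalgebras given by monomials *)

Section ZmodMorphism.
Variables (U V : zmodType) (D : U -> V).
Hypothesis DB : zmod_morphism D.

Lemma zmod_morph0 : D 0 = 0. Proof. by have := DB 0 0; rewrite !subrr. Qed.
Lemma zmod_morphN x : D (- x) = - D x.
Proof. by rewrite -sub0r DB zmod_morph0 sub0r. Qed.
Lemma zmod_morphD x y : D (x + y) = D x + D y.
Proof. by rewrite -{1}(opprK y) DB zmod_morphN opprK. Qed.
End ZmodMorphism.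

Module SuperAlgebraTheory.
Import monalg SuperAlgebra.

(* [superalg] seen through its monomials. The theory is developed for an abstract
   ring carrying this structure because the type checker otherwise unfolds the
   finitely supported functions behind [superalg] when it compares products. *)
Record supermonomials (L : comNzRingType) (X : choiceType) (Y : countType)
    (A : nzRingType) := SuperMonomials {
  mono : L -> smonom X Y -> A;
  coef : smonom X Y -> A -> L;
  linext : (L -> smonom X Y -> A) -> A -> A;
  monoB : forall k, zmod_morphism (mono ^~ k);
  monoM : forall c k e l,
    mono c k * mono e l = mono (c * e * ssign L k l) (smul k l);
  mono1 : mono 1 (sone X Y) = 1;
  mono_ind : forall P : A -> Prop, (forall f g, P f -> P g -> P (f + g)) ->
    (forall c k, P (mono c k)) -> forall f, P f;
  coefB : forall k, zmod_morphism (coef k);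
  coef_mono : forall c k l, coef l (mono c k) = c *+ (k == l);
  coef_ext : forall f g, (forall k, coef k f = coef k g) -> f = g;
  linextB : forall F, (forall k, zmod_morphism (F ^~ k)) ->
    zmod_morphism (linext F);
  linext_mono : forall F c k, (forall k, zmod_morphism (F ^~ k)) ->
    linext F (mono c k) = F c k
}.

Arguments mono_ind {L X Y A} S P : rename.
Arguments coef_ext {L X Y A} S : rename.
Arguments mono1 {L X Y A} S : rename.

Local Open Scope fset_scope.

Section Concrete.
Variables (L : comNzRingType) (X : choiceType) (Y : countType).
Local Notation A := (superalg L X Y).
Local Notation mon := (smonom X Y).
Implicit Types (f g : A) (c e : L) (k l : mon).

Let monom_is_zmod_morphism k : zmod_morphism (fun c : L => sterm c k : A).
Proof. by move=> a b; rewrite /sterm; exact: monalgUB. Qed.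

Let smultw (d e : {fset mon}) f g : msupp f `<=` d -> msupp g `<=` e ->
  (f * g = \sum_(k <- d) \sum_(l <- e)
    sterm (f@_k * g@_l * ssign L k l) (smul k l))%R.
Proof.
move=> led lee; rewrite -[LHS]/(smult f g) /smult (big_fset_incl _ led) /=.
  apply/eq_bigr=> k1 _; apply/big_fset_incl => // k _ /mcoeff_outdom ->.
  by rewrite mulr0 mul0r; exact: monalgU0.
move=> k _ /mcoeff_outdom fk.
by rewrite big1 // => k' _; rewrite fk !mul0r; exact: monalgU0.
Qed.

Let stermM c k e l :
  (sterm c k * sterm e l = sterm (c * e * ssign L k l) (smul k l) :> A)%R.
Proof. by rewrite (smultw msuppU_le msuppU_le) !big_seq_fset1 !mcoeffUU. Qed.

Let sterm_ind (P : A -> Prop) :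
  (forall f g, P f -> P g -> P (f + g)%R) -> (forall c k, P (sterm c k)) ->
  forall f, P f.
Proof.
move=> PD Pm f; rewrite [f]monalgE; elim/big_ind: _ => // [|k _]; last exact: Pm.
by have <- : sterm 0%R (sone X Y) = 0%R :> A by [exact: monalgU0]; exact: Pm.
Qed.

Let mcoeff_is_zmod_morphism k : zmod_morphism (fun f : A => f@_k).
Proof. exact: mcoeffB. Qed.

Let mcoeff_sterm c k l : (sterm c k : A)@_l = c *+ (k == l).
Proof. exact: mcoeffU. Qed.

Let mcoeff_ext f g : (forall k, f@_k = g@_k) -> f = g.
Proof. by move=> /malgP. Qed.

Let lin (F : L -> mon -> A) f : A := (\sum_(k <- msupp f) F f@_k k)%R.

Let lin_wide (F : L -> mon -> A) (d : {fset mon}) f :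
    (forall k, zmod_morphism (F ^~ k)) -> msupp f `<=` d ->
  lin F f = (\sum_(k <- d) F f@_k k)%R.
Proof.
move=> FB le; rewrite /lin (big_fset_incl _ le) // => k _ /mcoeff_outdom ->.
exact: zmod_morph0 (FB k).
Qed.

Let lin_is_zmod_morphism F :
  (forall k, zmod_morphism (F ^~ k)) -> zmod_morphism (lin F).
Proof.
move=> FB f g; rewrite (lin_wide FB (msuppB_le f g)) (lin_wide FB (fsubsetUl _ (msupp g))).
rewrite (lin_wide FB (fsubsetUr (msupp f) _)) -sumrB.
by apply: eq_bigr => k _; rewrite -FB mcoeffB.
Qed.

Let lin_sterm F c k : (forall k, zmod_morphism (F ^~ k)) -> lin F (sterm c k) = F c k.
Proof. by move=> FB; rewrite (lin_wide FB msuppU_le) big_seq_fset1 mcoeffUU. Qed.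

Definition superalg_monomials : supermonomials L X Y A :=
  SuperMonomials monom_is_zmod_morphism stermM erefl sterm_ind
    mcoeff_is_zmod_morphism mcoeff_sterm mcoeff_ext lin_is_zmod_morphism lin_sterm.
End Concrete.

Section Theory.
Variables (L : comNzRingType) (X : choiceType) (Y : countType) (A : nzRingType).
Variable S : supermonomials L X Y A.
Local Notation mon := (smonom X Y).
Local Notation sterm := (mono S).
Implicit Types (f g h : A) (c e : L) (k l : mon) (x : X) (y : Y) (p q : bool).

HB.instance Definition _ k := GRing.isZmodMorphism.Build A L (coef S k) (@coefB _ _ _ _ S k).

Definition scst c : A := sterm c (sone X Y).
Definition evengen x : A := sterm 1 (ucm x, fset0).
Definition oddgen y : A := sterm 1 (mone, [fset y]).

Lemma stermN c k : sterm (- c) k = - sterm c k.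
Proof. exact/(zmod_morphN (D := mono S ^~ k))/monoB. Qed.
Lemma stermD c e k : sterm (c + e)%R k = (sterm c k + sterm e k)%R.
Proof. exact/(zmod_morphD (D := mono S ^~ k))/monoB. Qed.
Lemma sterm0 k : sterm 0 k = 0.
Proof. exact/(zmod_morph0 (D := mono S ^~ k))/monoB. Qed.

Lemma scst_sterm c e k : (scst c * sterm e k = sterm (c * e) k)%R.
Proof. by rewrite monoM ssign1 mulr1 smul1. Qed.

Lemma scstC c f : (scst c * f = f * scst c)%R.
Proof.
elim/(mono_ind S): f => [f g|e l]; first by rewrite mulrDr mulrDl => -> ->.
by rewrite scst_sterm monoM ssignr1 smulr1 mulr1 mulrC.
Qed.

Lemma scst_is_zmod_morphism : zmod_morphism scst.
Proof. by move=> a b; rewrite /scst stermD stermN. Qed.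
Lemma scst_is_monoid_morphism : monoid_morphism scst.
Proof. by split=> [|a b]; [exact: mono1 | rewrite scst_sterm]. Qed.
HB.instance Definition _ := GRing.isZmodMorphism.Build L A scst scst_is_zmod_morphism.
HB.instance Definition _ := GRing.isMonoidMorphism.Build L A scst
  scst_is_monoid_morphism.

(** Generators are peeled off a monomial from the left, the odd ones by induction on their number
    and then the even ones by induction on the degree. The sign for sorting an odd generator into
    its place squares to 1 and can be moved into the coefficient. *)
Lemma superalg_ind (P : A -> Prop) :
  (forall f g, P f -> P g -> P (f + g)%R) -> (forall c, P (scst c)) ->
  (forall x f, P f -> P (evengen x * f)%R) ->
  (forall y f, P f -> P (oddgen y * f)%R) -> forall f, P f.
Proof.
move=> PD Pc Px Py; apply: (mono_ind S) => // c [m T].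
have [n] := ubnP #|` T|; elim: n c T => // n IH c T ltn.
have [->|[y yS]] := fset_0Vmem T.
  have [r] := ubnP (monalg.mdeg m); elim: r {IH ltn} m c => // r IHr m c ltr.
  have [m1|[x xm]] := fset_0Vmem (finsupp m).
    suff -> : m = mone by apply: Pc.
    by apply/eqP/cmP => i; rewrite cm1; apply/eqP; rewrite cmE_eq0 m1 in_fset0.
  have mE : m = mmul (ucm x) (divcm m (ucm x)).
    apply/eqP/cmP => i; rewrite cmM divcmE ucmE; case: eqP => [<-|]; last by rewrite subn0.
    by rewrite subnKC // lt0n cmE_neq0.
  have -> : sterm c (m, fset0) = (evengen x * sterm c (divcm m (ucm x), fset0))%R.
    by rewrite monoM /smul /ssign /= -mE fsetU0 fdisjointX0 /ninv big_seq_fset0 mul1r mulr1.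
  apply/Px/IHr; move: ltr; rewrite {1}mE mdegM mdegU add1n ltnS.
  exact: leq_trans.
have disj : [disjoint [fset y] & T `\ y] by rewrite fdisjoint1X in_fsetD1 eqxx.
have -> : sterm c (m, T) = (oddgen y *
   sterm ((-1) ^+ ninv [fset y] (T `\ y) * c) (m, T `\ y))%R.
  rewrite monoM /smul /ssign /= fsetD1K // disj mul1m mul1r.
  by rewrite mulrAC -expr2 sqrr_sign mul1r.
by apply/Py/IH; move: ltn; rewrite (cardfsD1 y) yS ltnS.
Qed.

(** The grading involution. It carries the signs of commutation and of the Leibniz rule, so that
    these can be stated for functionals that are not homogeneous. *)
Definition parity : A -> A := linext S (fun c k => sterm ((-1) ^+ #|` k.2| * c)%R k).

Let parity_termB k : zmod_morphism (fun c => sterm ((-1) ^+ #|` k.2| * c)%R k).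
Proof. by move=> a b /=; rewrite mulrBr stermD stermN. Qed.

Lemma parity_sterm c k : parity (sterm c k) = sterm ((-1) ^+ #|` k.2| * c)%R k.
Proof. exact: linext_mono. Qed.

Lemma parity_is_zmod_morphism : zmod_morphism parity.
Proof. exact: linextB. Qed.

HB.instance Definition _ := GRing.isZmodMorphism.Build A A parity
  parity_is_zmod_morphism.

Lemma parity_is_monoid_morphism : monoid_morphism parity.
Proof.
split=> [|f g]; first by rewrite -(mono1 S) parity_sterm cardfs0 mul1r.
move: f; apply: (mono_ind S) => [f f'|c k].
  by rewrite mulrDl !raddfD /= mulrDl => -> ->.
move: g; apply: (mono_ind S) => [f f'|e l].
  by rewrite mulrDr !raddfD /= mulrDr => -> ->.
rewrite monoM !parity_sterm monoM /ssign /=; case: ifP => [dkl|_]; last first.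
  by rewrite !mulr0 !sterm0.
congr sterm; have -> : #|` k.2 `|` l.2| = (#|` k.2| + #|` l.2|)%N.
  by rewrite cardfsU; move: dkl; rewrite /fdisjoint => /eqP ->; rewrite cardfs0 subn0.
by rewrite exprD; ring.
Qed.
HB.instance Definition _ := GRing.isMonoidMorphism.Build A A parity
  parity_is_monoid_morphism.

Lemma parity_scst c : parity (scst c) = scst c.
Proof. by rewrite parity_sterm cardfs0 mul1r. Qed.
Lemma parity_evengen x : parity (evengen x) = evengen x.
Proof. by rewrite parity_sterm cardfs0 mul1r. Qed.
Lemma parity_oddgen y : parity (oddgen y) = - oddgen y.
Proof. by rewrite parity_sterm cardfs1 expr1 mulN1r stermN. Qed.

Definition parityX p f := if p then parity f else f.

Lemma parityX_scst p c : parityX p (scst c) = scst c.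
Proof. by case: p; rewrite //= parity_scst. Qed.
Lemma parityX_evengen p x : parityX p (evengen x) = evengen x.
Proof. by case: p; rewrite //= parity_evengen. Qed.
Lemma parityX_oddgen p y : parityX p (oddgen y) = ((-1) ^+ p * oddgen y)%R.
Proof. by case: p; rewrite /= ?parity_oddgen ?mul1r ?mulN1r. Qed.
Lemma parityXM p f g : parityX p (f * g)%R = (parityX p f * parityX p g)%R.
Proof. by case: p; rewrite //= rmorphM. Qed.
Lemma parityXD p f g : parityX p (f + g)%R = (parityX p f + parityX p g)%R.
Proof. by case: p; rewrite //= raddfD. Qed.

(** Every element of [T] comes either before or after [y], hence is an inversion in exactly one of
    the two orders of the product. This is the source of the sign in [oddgenC]. *)
Lemma ninv_oddgen y (T : {fset Y}) : y \notin T ->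
  (ninv [fset y] T + ninv T [fset y] = #|` T|)%N.
Proof.
move=> yS; rewrite /ninv big_seq_fset1 -big_split /= cardfE -sum1_card.
rewrite big_seq_fsetE /=; apply: eq_bigr => z _; rewrite big_seq_fset1.
have : choice.pickle (val z) != choice.pickle y.
  by apply: contraNneq yS => /(pcan_inj choice.pickleK) <-; exact: valP.
by case: ltngtP.
Qed.

Lemma oddgenC y f : (oddgen y * f = parity f * oddgen y)%R.
Proof.
move: f; apply: (mono_ind S) => [f g|c k].
  by rewrite mulrDr raddfD mulrDl /= => -> ->.
rewrite parity_sterm !monoM /ssign /smul /= fdisjoint1X fdisjointX1 fsetUC.
rewrite mulmC mul1r mulr1; case: (boolP (y \in k.2)) => [_|yk]; first by rewrite !mulr0.
congr sterm; rewrite -(ninv_oddgen yk) exprD.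
by rewrite [RHS]mulrAC -[X in (X * c)%R]mulrA -expr2 sqrr_sign mulr1 mulrC.
Qed.

Lemma evengenC x f : (evengen x * f = f * evengen x)%R.
Proof.
move: f; apply: (mono_ind S) => [f g|c k].
  by rewrite mulrDr mulrDl /= => -> ->.
rewrite !monoM /ssign /smul /= fdisjoint0X fdisjointX0 fsetUC.
rewrite mulmC mul1r mulr1 /ninv big_seq_fset0 big1 // => y _.
exact: big_seq_fset0.
Qed.

Lemma oddgen_sterm_in y c k : y \in k.2 -> (oddgen y * sterm c k)%R = 0.
Proof. by move=> yk; rewrite monoM /ssign /= fdisjoint1X yk mulr0 sterm0. Qed.

Lemma oddgen_sterm y c k : y \notin k.2 ->
  (oddgen y * sterm c k)%R = sterm ((-1) ^+ ninv [fset y] k.2 * c)%R (k.1, y |` k.2).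
Proof.
by move=> yk; rewrite monoM /ssign /smul /= fdisjoint1X yk mul1r mul1m mulrC.
Qed.

Lemma evengen_sterm x c k :
  (evengen x * sterm c k)%R = sterm c (mmul (ucm x) k.1, k.2).
Proof.
rewrite monoM /ssign /smul /= fdisjoint0X /ninv big_seq_fset0.
by rewrite mul1r mulr1 fset0U.
Qed.

(** * Superderivations and their commutators *)

Section Derivations.
Implicit Types D : A -> A.

Definition superderivation p D :=
  zmod_morphism D /\ forall f g, (D (f * g) = D f * g + parityX p f * D g)%R.

Lemma superderivation_gen p D : zmod_morphism D ->
  (forall c g, D (scst c * g) = D (scst c) * g + scst c * D g)%R ->
  (forall x g, D (evengen x * g) = D (evengen x) * g + evengen x * D g)%R ->
  (forall y g, D (oddgen y * g) = D (oddgen y) * g + (-1) ^+ p * oddgen y * D g)%R ->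
  superderivation p D.
Proof.
move=> Dadd Dc Dx Dy; split=> // f g.
have DD := zmod_morphD Dadd.
elim/superalg_ind: f => [f f' IH IH'|c|x f IH|y f IH].
- by rewrite mulrDl !DD IH IH' parityXD !mulrDl addrACA.
- by rewrite Dc parityX_scst.
- by rewrite -mulrA !Dx IH parityXM parityX_evengen !mulrDl !mulrDr !mulrA addrA.
- by rewrite -mulrA !Dy IH parityXM parityX_oddgen !mulrDl !mulrDr !mulrA addrA.
Qed.

(* [D T - T D - E] is a superderivation, hence determined by the generators. *)
Lemma commutator_gen p D E T :
  superderivation p D -> superderivation p E -> superderivation false T ->
  (forall f, T (parity f) = parity (T f)) ->
  (forall c, D (T (scst c)) = T (D (scst c)) + E (scst c))%R ->
  (forall x, D (T (evengen x)) = T (D (evengen x)) + E (evengen x))%R ->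
  (forall y, D (T (oddgen y)) = T (D (oddgen y)) + E (oddgen y))%R ->
  forall f, (D (T f) = T (D f) + E f)%R.
Proof.
move=> [Dadd DM] [Eadd EM] [Tadd TM] Tpar Hc Hx Hy.
have Tp f : T (parityX p f) = parityX p (T f) by case: p {Dadd DM Eadd EM Hc Hx Hy} => /=.
have step g f : (D (T g) = T (D g) + E g)%R -> (D (T f) = T (D f) + E f)%R ->
    (D (T (g * f)) = T (D (g * f)) + E (g * f))%R.
  move=> Hg Hf; rewrite TM /= (zmod_morphD Dadd) (DM _ f) (DM g) Hg Hf DM (zmod_morphD Tadd).
  rewrite !TM /= Tp EM !mulrDl !mulrDr !addrA.
  by rewrite [LHS](ACl (1*4*3*5*2*6)%AC).
apply: superalg_ind => [f g|//|x f|y f]; [|exact: step..].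
by rewrite !(zmod_morphD Tadd, zmod_morphD Dadd, zmod_morphD Eadd) => -> ->; rewrite addrACA.
Qed.
End Derivations.

(** * Derivatives of coefficients and left partial derivatives by generators *)

Section Partials.

Let evend_term x c k : A := sterm (c *+ k.1 x)%R (divcm k.1 (ucm x), k.2).
Let oddd_term y c k : A := if y \in k.2 then
  sterm ((-1) ^+ ninv [fset y] k.2 * c)%R (k.1, k.2 `\ y) else 0%R.

Definition coefd (D : L -> L) : A -> A := linext S (fun c k => sterm (D c) k).
Definition evend x : A -> A := linext S (evend_term x).
Definition oddd y : A -> A := linext S (oddd_term y).

Let coefd_termB D k : zmod_morphism D -> zmod_morphism (fun c => sterm (D c) k).
Proof. by move=> DB a b; rewrite DB stermD stermN. Qed.
Let evend_termB x k : zmod_morphism (fun c => evend_term x c k).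
Proof. by move=> a b; rewrite /evend_term mulrnBl stermD stermN. Qed.
Let oddd_termB y k : zmod_morphism (fun c => oddd_term y c k).
Proof.
by move=> a b; rewrite /oddd_term; case: ifP => _; rewrite ?subrr // mulrBr stermD stermN.
Qed.

Let evendB x : zmod_morphism (evend x). Proof. exact: linextB. Qed.
Let odddB y : zmod_morphism (oddd y). Proof. exact: linextB. Qed.
Lemma coefdB D : zmod_morphism D -> zmod_morphism (coefd D).
Proof. by move=> DB; apply: linextB => k; exact: coefd_termB. Qed.

HB.instance Definition _ x := GRing.isZmodMorphism.Build A A (evend x) (@evendB x).
HB.instance Definition _ y := GRing.isZmodMorphism.Build A A (oddd y) (@odddB y).

Lemma coefd_sterm D c k : zmod_morphism D -> coefd D (sterm c k) = sterm (D c) k.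
Proof.
by move=> DB; rewrite /coefd linext_mono // => {}k; exact: coefd_termB.
Qed.
Lemma evend_sterm x c k :
  evend x (sterm c k) = sterm (c *+ k.1 x)%R (divcm k.1 (ucm x), k.2).
Proof. exact: linext_mono. Qed.
Lemma oddd_sterm y c k : oddd y (sterm c k) =
  if y \in k.2 then sterm ((-1) ^+ ninv [fset y] k.2 * c)%R (k.1, k.2 `\ y) else 0%R.
Proof. exact: linext_mono. Qed.

Lemma coefd_superderivation D : zmod_morphism D ->
  (forall a b, D (a * b) = D a * b + a * D b)%R -> superderivation false (coefd D).
Proof.
move=> DB DM; have CB := coefdB DB.
have D1 : D 1%R = 0%R.
  by have := DM 1%R 1%R; rewrite !(mulr1, mul1r) -{1}[D 1%R]addr0 => /addrI.
apply: superderivation_gen => // [c|x|y]; apply: (mono_ind S) => [f g|e k];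
  rewrite ?mulrDr ?(zmod_morphD CB) ?mulrDr; try (by move=> -> ->; rewrite addrACA).
- by rewrite scst_sterm !coefd_sterm // !scst_sterm DM stermD.
- by rewrite evengen_sterm !coefd_sterm // evengen_sterm D1 sterm0 mul0r add0r.
- rewrite mul1r !coefd_sterm // D1 sterm0 mul0r add0r.
  have [yk|yk] := boolP (y \in k.2).
    by rewrite !oddgen_sterm_in // (zmod_morph0 CB).
  rewrite !oddgen_sterm // coefd_sterm //; congr sterm.
  have DN z : D (- z)%R = (- D z)%R.
    exact: zmod_morphN.
  by rewrite -signr_odd; case: odd; rewrite ?mul1r // !mulN1r DN.
Qed.

Lemma evend_scst x c : evend x (scst c) = 0%R.
Proof. by rewrite evend_sterm /= onecmE mulr0n sterm0. Qed.
Lemma evend_evengen x z : evend x (evengen z) = (z == x)%:R%R.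
Proof.
rewrite evend_sterm /= ucmE; case: eqP => [->|_]; last by rewrite sterm0.
have -> : divcm (ucm x) (ucm x) = mone.
  by apply/eqP/cmP => i; rewrite divcmE cm1 subnn.
exact: mono1.
Qed.
Lemma evend_oddgen x y : evend x (oddgen y) = 0%R.
Proof. by rewrite evend_sterm /= cm1 mulr0n sterm0. Qed.

Lemma oddd_scst y c : oddd y (scst c) = 0%R.
Proof. by rewrite oddd_sterm in_fset0. Qed.
Lemma oddd_evengen y x : oddd y (evengen x) = 0%R.
Proof. by rewrite oddd_sterm in_fset0. Qed.
Lemma oddd_oddgen y z : oddd y (oddgen z) = (z == y)%:R%R.
Proof.
rewrite oddd_sterm in_fset1 eq_sym; case: eqP => // ->.
by rewrite /= fsetDv /ninv !big_seq_fset1 ltnn mul1r; exact: mono1.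
Qed.

Lemma evend_superderivation x : superderivation false (evend x).
Proof.
apply: superderivation_gen => // [c|z|y]; apply: (mono_ind S) => [f g|e k];
  rewrite ?mulrDr ?raddfD ?mulrDr /=; try (by move=> -> ->; rewrite addrACA).
- by rewrite scst_sterm evend_scst mul0r add0r !evend_sterm scst_sterm mulrnAr.
- rewrite evengen_sterm evend_evengen !evend_sterm /= evengen_sterm /= cmM ucmE.
  rewrite mulrnDr stermD; congr (_ + _)%R.
    case: eqP => [->|_]; last by rewrite mul0r mulr0n sterm0.
    rewrite mul1r mulr1n [in RHS](surjective_pairing k); congr (sterm _ (_, _)).
    by apply/eqP/cmP => i; rewrite divcmE cmM addKn.
  have [k0|kp] := posnP (k.1 x); first by rewrite k0 !mulr0n !sterm0.
  congr (sterm _ (_, _)); apply/eqP/cmP => i; rewrite !(divcmE, cmM, ucmE).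
  by case: (eqVneq x i) => [<-|_]; rewrite ?subn0 // addnBA.
- rewrite evend_oddgen mul0r add0r mul1r; have [yk|yk] := boolP (y \in k.2).
    by rewrite evend_sterm !oddgen_sterm_in // raddf0.
  by rewrite oddgen_sterm // !evend_sterm oddgen_sterm //= mulrnAr.
Qed.

Lemma oddd_superderivation y : superderivation true (oddd y).
Proof.
apply: superderivation_gen => // [c|x|z]; apply: (mono_ind S) => [f g|e k];
  rewrite ?mulrDr ?raddfD ?mulrDr /=; try (by move=> -> ->; rewrite addrACA).
- rewrite scst_sterm oddd_scst mul0r add0r !oddd_sterm.
  by case: ifP => _; rewrite ?mulr0 // scst_sterm mulrCA.
- rewrite evengen_sterm oddd_evengen mul0r add0r !oddd_sterm /=.
  by case: ifP => _; rewrite ?mulr0 // evengen_sterm.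
rewrite expr1 mulN1r mulNr oddd_oddgen.
have ninv1U (a b : Y) (T : {fset Y}) : b \notin T ->
    ninv [fset a] (b |` T) = ((choice.pickle b < choice.pickle a) + ninv [fset a] T)%N.
  by move=> bS; rewrite /ninv !big_seq_fset1 big_fsetU1.
have ninv1D (a b : Y) (T : {fset Y}) : b \in T ->
    ninv [fset a] T = ((choice.pickle b < choice.pickle a) + ninv [fset a] (T `\ b))%N.
  by move=> bS; rewrite -ninv1U ?fsetD1K // in_fsetD1 eqxx.
have signK n c : ((-1) ^+ n * ((-1) ^+ n * c) = c)%R.
  by rewrite mulrA -expr2 sqrr_sign mul1r.
have [zk|zk] := boolP (z \in k.2).
  rewrite oddgen_sterm_in // raddf0 oddd_sterm; case: (eqVneq z y) zk => [->|zy] zk.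
    rewrite zk mul1r oddgen_sterm /= ?in_fsetD1 ?eqxx // fsetD1K //.
    by rewrite (ninv1D _ _ _ zk) ltnn add0n signK -surjective_pairing subrr.
  rewrite mul0r sub0r; case: ifP => _; last by rewrite mulr0 oppr0.
  by rewrite oddgen_sterm_in ?oppr0 //= in_fsetD1 zy zk.
rewrite oddgen_sterm // !oddd_sterm /= in_fsetU in_fset1.
case: (eqVneq y z) zk => [->|yz] zk /=.
  rewrite (negbTE zk) mulr0 subr0 mul1r ninv1U // ltnn add0n signK.
  by rewrite fsetU1K // -surjective_pairing.
rewrite mul0r sub0r; case: ifP => yk; last by rewrite mulr0 oppr0.
rewrite oddgen_sterm /= ?in_fsetD1 ?(negbTE zk) ?andbF // -stermN; congr (sterm _ (_, _)).
  rewrite ninv1U // (ninv1D z _ _ yk) !exprD.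
  (* Exactly one of [y] and [z] precedes the other, so exactly one of the two signs changes: this is
     their anticommutation. *)
  have : choice.pickle y != choice.pickle z.
    by apply: contraNneq yz => /(pcan_inj choice.pickleK) ->.
  by case: ltngtP => //= _ _; rewrite expr0 expr1; ring.
by rewrite fsetDUl; congr (_ `|` _); apply/fsetP => i; rewrite in_fsetD1 in_fset1;
   case: eqVneq => // ->; rewrite (negbTE yz).
Qed.

(** Together with [coef_oddd] this recovers the coefficient of [f] at a monomial containing a
    generator from the partial derivative by that generator, as [pderiv_eq0_const] requires. *)
Lemma coef_evend x f l :
  coef S l (evend x f) = (coef S (mmul (ucm x) l.1, l.2) f *+ (l.1 x).+1)%R.
Proof.
move: f; apply: (mono_ind S) => [f g|c k].
  by rewrite raddfD !raddfD /= mulrnDl => -> ->.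
rewrite evend_sterm !coef_mono; case: (eqVneq k _) => [->|kl] /=.
  rewrite cmM ucmE eqxx add1n (_ : _ == l) // -pair_eqE; case: l => a b /=.
  by rewrite eqxx andbT; apply/cmP => i; rewrite divcmE cmM addKn.
rewrite mulr0n mul0rn; have [k0|kp] := posnP (k.1 x); first by rewrite k0 mul0rn.
case: eqP => [E|//]; case/eqP: kl; rewrite -E [LHS]surjective_pairing; congr (_, _).
apply/eqP/cmP => i; rewrite cmM divcmE ucmE; case: eqP => [<-|_]; last by rewrite subn0.
by rewrite subnKC.
Qed.

Lemma coef_oddd y f l : y \notin l.2 ->
  coef S l (oddd y f) = ((-1) ^+ ninv [fset y] (y |` l.2) * coef S (l.1, y |` l.2) f)%R.
Proof.
move=> yl; move: f; apply: (mono_ind S) => [f g|c k].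
  by rewrite raddfD !raddfD /= mulrDr => -> ->.
rewrite oddd_sterm coef_mono; case: (eqVneq k _) => [->|kl] /=.
  by rewrite in_fsetU in_fset1 eqxx /= coef_mono fsetU1K // -surjective_pairing eqxx.
rewrite mulr0n mulr0; case: ifP => [yk|_]; last by rewrite raddf0.
rewrite coef_mono; case: eqP => [E|_]; last by rewrite mulr0n.
by case/eqP: kl; rewrite -E /= fsetD1K // -surjective_pairing.
Qed.

End Partials.
End Theory.
End SuperAlgebraTheory.

(** * Jet calculus over an abstract superalgebra *)

Import monalg PowerSeries PowerSeriesTheory SuperAlgebra SuperAlgebraTheory.

HB.instance Definition _ d N nH nS nI := gen_eqMixin (field d N nH nS nI).

Section JetCalculus.
Variables (d N nH nS nI : nat) (K : numFieldType) (A : nzRingType).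
Local Notation mi := (mindex d).
Local Notation fld := (field d N nH nS nI).
Local Notation xg := (xgen d N nH nS nI).
Local Notation yg := (ygen d N).
Local Notation L := (mps (d * d) K).
Local Notation Viel mu m := (Vielbein N nH nS nI mu m).
Local Notation Gh y := (Gho nH nS nI y).
Variable S : supermonomials L xg yg A.
Implicit Types (f g : A) (z : fld * mi) (I J : mi) (v : fld -> mi -> A).

Definition is_odd (phi : fld) := if phi is Gho _ then true else false.

Definition vielb : 'M[L]_d :=
  \matrix_(mu, m) ((mu == m)%:R + mpsX K (mxvec_index mu m)).

(* The prefix [a] marks the counterpart, over the abstract algebra [A], of a notion
   defined for functionals; both sides are convertible when [A] is [functional M]. *)
Definition ajet (phi : fld) I : A :=
  match phi with
  | Vielbein mu m =>
      if insub I is Some J then evengen S (inl (mu, m, J)) else scst S (vielb mu m)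
  | Bos x => evengen S (inr (x, I))
  | Gho y => oddgen S (y, I)
  end.

Definition pderiv z : A -> A :=
  match z.1 with
  | Vielbein mu m => if insub z.2 is Some J then evend S (inl (mu, m, J))
                     else coefd S (mps_deriv (mxvec_index mu m))
  | Bos x => evend S (inr (x, z.2))
  | Gho y => oddd S (y, z.2)
  end.

(** Jet coordinates according to where they live: among the power series variables, the even
    generators or the odd generators. Statements are uniform in the field, but computations split in
    this way. *)
Variant jet_kind : fld * mi -> Type :=
| JetVielbein mu m : jet_kind (Viel mu m, 0)
| JetEven (x : xg) : jet_kind (xjet x)
| JetOdd (y : yg) : jet_kind (Gh y.1, y.2).

Lemma jet_kindP z : jet_kind z.
Proof.
case: z => [[mu m|x|y] I].
- have [->|I0] := eqVneq I 0; first exact: JetVielbein.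
  exact: (JetEven (inl (mu, m, exist _ I I0))).
- exact: (JetEven (inr (x, I))).
- exact: (JetOdd (y, I)).
Qed.

Lemma ajet_vielbein mu m : ajet (Viel mu m) 0 = scst S (vielb mu m).
Proof. by rewrite /= insubF // eqxx. Qed.
Lemma ajet_even x : ajet (xjet x).1 (xjet x).2 = evengen S x.
Proof. by case: x => [[[mu m] J]|[x J]] //=; rewrite valK. Qed.

Lemma pderiv_vielbein mu m : pderiv (Viel mu m, 0) = coefd S (mps_deriv (mxvec_index mu m)).
Proof. by rewrite /pderiv /= insubF // eqxx. Qed.
Lemma pderiv_even x : pderiv (xjet x) = evend S x.
Proof. by case: x => [[[mu m] J]|[x J]] //=; rewrite /pderiv /= valK. Qed.
Lemma pderiv_odd y : pderiv (Gh y.1, y.2) = oddd S y.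
Proof. by case: y. Qed.

Let dB (i : 'I_(d * d)) : zmod_morphism (mps_deriv i : L -> L).
Proof. exact: raddfB. Qed.

Lemma is_odd_xjet (x : xg) : is_odd (xjet x).1 = false.
Proof. by case: x => [[[mu m] J]|[x J]]. Qed.

Lemma pderiv_superderivation z : superderivation S (is_odd z.1) (pderiv z).
Proof.
case: (jet_kindP z) => [mu m|x|y] /=.
- rewrite pderiv_vielbein; apply: coefd_superderivation; [exact: dB | exact: mps_derivM].
- by rewrite pderiv_even is_odd_xjet; exact: evend_superderivation.
- by rewrite pderiv_odd; exact: oddd_superderivation.
Qed.

Lemma pderiv_is_zmod_morphism z : zmod_morphism (pderiv z).
Proof. by case: (pderiv_superderivation z). Qed.
HB.instance Definition _ z := GRing.isZmodMorphism.Build A A (pderiv z)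
  (@pderiv_is_zmod_morphism z).

Lemma pderivM z f g : pderiv z (f * g) = pderiv z f * g + parityX S (is_odd z.1) f * pderiv z g.
Proof. by case: (pderiv_superderivation z). Qed.

Lemma eq_mxvec_index (i i' j j' : 'I_d) :
  (mxvec_index i j == mxvec_index i' j') = (i == i') && (j == j').
Proof.
rewrite /mxvec_index (inj_eq (@cast_ord_inj _ _ _)) (inj_eq enum_rank_inj).
by rewrite -pair_eqE.
Qed.

Lemma xjet_inj : injective (@xjet d N nH nS nI).
Proof.
move=> [[[mu m] J]|[x J]] [[[mu' m'] J']|[x' J']] //= [].
  by move=> -> -> /val_inj ->.
by move=> -> ->.
Qed.

Lemma coefd_even (D : L -> L) x : zmod_morphism D -> D 1 = 0 -> coefd S D (evengen S x) = 0.
Proof. by move=> DB D1; rewrite coefd_sterm // D1 sterm0. Qed.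
Lemma coefd_odd (D : L -> L) y : zmod_morphism D -> D 1 = 0 -> coefd S D (oddgen S y) = 0.
Proof. by move=> DB D1; rewrite coefd_sterm // D1 sterm0. Qed.

Lemma pderiv_scst z c : pderiv z (scst S c) =
  if z is (Vielbein mu m, J) then
    if J == 0 then scst S (mps_deriv (mxvec_index mu m) c) else 0 else 0.
Proof.
case: (jet_kindP z) => [mu m|x|y] /=.
- by rewrite eqxx pderiv_vielbein coefd_sterm.
- rewrite pderiv_even evend_scst; case: x => [[[mu m] J]|[x J]] //=.
  by rewrite (negbTE (valP J)).
- by rewrite pderiv_odd oddd_scst.
Qed.

Lemma pderiv_jet z phi I : pderiv z (ajet phi I) = (z == (phi, I))%:R.
Proof.
suff gen w : pderiv z (ajet w.1 w.2) = (z == w)%:R by exact: (gen (phi, I)).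
case: (jet_kindP w) => [mu' m'|x'|y'].
- rewrite /= -/(ajet (Viel mu' m') 0) ajet_vielbein pderiv_scst; case: z => [[mu m|x|y] J]; [|by case: eqP..].
  case: (eqVneq J 0) => [->|J0]; last by case: eqP => // E; rewrite (congr1 snd E : J = 0) eqxx in J0.
  rewrite mxE raddfD /= raddfMn /= mps_deriv1 mul0rn add0r mps_derivX rmorph_nat.
  congr (_ %:R); rewrite eq_mxvec_index; congr nat_of_bool.
  by apply/andP/eqP => [[/eqP -> /eqP ->]|[-> ->]].
- rewrite ajet_even; case: (jet_kindP z) => [mu m|x|y].
  + rewrite pderiv_vielbein coefd_even ?mps_deriv1 //; case: eqP => //.
    by case: x' => [[[mu' m'] J]|[x J]] // [_ _ J0]; have := valP J; rewrite /= -J0 eqxx.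
  + by rewrite pderiv_even evend_evengen (inj_eq xjet_inj) eq_sym.
  + rewrite pderiv_odd oddd_evengen; case: eqP => //.
    by case: x' => [[[mu' m'] J]|[x J]].
- case: (jet_kindP z) => [mu m|x|y].
  + by rewrite pderiv_vielbein coefd_odd ?mps_deriv1 //; case: eqP.
  + rewrite pderiv_even evend_oddgen; case: eqP => //.
    by case: x => [[[mu' m'] J]|[x J]].
  + rewrite pderiv_odd [ajet _ _](_ : _ = oddgen S y'); last by case: (y').
    rewrite oddd_oddgen; congr (_ %:R); congr nat_of_bool.
    by case: y y' => [y I1] [y' I2]; apply/eqP/eqP => [[-> ->]|[-> ->]].
Qed.

Definition asuperder v : A -> A := linext S (fun c k =>
    (\sum_mu \sum_m v (Viel mu m) 0 *
        mono S (mps_deriv (mxvec_index mu m) c) k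
     + \sum_(x <- finsupp k.1) v (xjet x).1 (xjet x).2 *
        mono S (c *+ k.1 x) (divcm k.1 (ucm x), k.2)
     + \sum_(y <- k.2) v (Gh y.1) y.2 *
        mono S ((-1) ^+ ninv [fset y]%fset k.2 * c)
              (k.1, (k.2 `\ y)%fset))).

Let asuperder_termB v k : zmod_morphism (fun c : L =>
    (\sum_mu \sum_m v (Viel mu m) 0 *
        mono S (mps_deriv (mxvec_index mu m) c) k
     + \sum_(x <- finsupp k.1) v (xjet x).1 (xjet x).2 *
        mono S (c *+ k.1 x) (divcm k.1 (ucm x), k.2)
     + \sum_(y <- k.2) v (Gh y.1) y.2 *
        mono S ((-1) ^+ ninv [fset y]%fset k.2 * c)
              (k.1, (k.2 `\ y)%fset))).
Proof.
move=> a b; rewrite opprD opprD [RHS]addrACA [X in _ = X + _]addrACA -!sumrB; congr (_ + _ + _).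
- apply: eq_bigr => mu _; rewrite -sumrB; apply: eq_bigr => m _.
  by rewrite raddfB stermD stermN mulrBr.
- by apply: eq_bigr => x _; rewrite mulrnBl stermD stermN mulrBr.
- by apply: eq_bigr => y _; rewrite mulrBr stermD stermN mulrBr.
Qed.

Lemma asuperder_is_zmod_morphism v : zmod_morphism (asuperder v).
Proof. exact: linextB. Qed.
HB.instance Definition _ v := GRing.isZmodMorphism.Build A A (asuperder v)
  (@asuperder_is_zmod_morphism v).

Lemma asuperder_mono v c k : asuperder v (mono S c k) =
   \sum_mu \sum_m v (Viel mu m) 0 * pderiv (Viel mu m, 0) (mono S c k)
   + \sum_(x <- finsupp k.1) v (xjet x).1 (xjet x).2 * pderiv (xjet x) (mono S c k)
   + \sum_(y <- k.2) v (Gh y.1) y.2 * pderiv (Gh y.1, y.2) (mono S c k).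
Proof.
rewrite /asuperder linext_mono //; congr (_ + _ + _).
- by apply: eq_bigr => mu _; apply: eq_bigr => m _; rewrite pderiv_vielbein coefd_sterm.
- by apply: eq_bigr => x _; rewrite pderiv_even evend_sterm.
- by rewrite big_seq [RHS]big_seq; apply: eq_bigr => y yk; rewrite pderiv_odd oddd_sterm yk.
Qed.

(* [s] contains the coordinates on which [f] depends, so that the infinite sum of
   partial derivatives behind [asuperder] may be taken over [s]. *)
Definition spans (s : seq (fld * mi)) f := uniq s /\ (forall z, z \notin s -> pderiv z f = 0) /\
   forall v, asuperder v f = \sum_(z <- s) v z.1 z.2 * pderiv z f.

Lemma spansW s s' f : uniq s' -> {subset s <= s'} -> spans s f -> spans s' f.
Proof.
move=> us' ss [us [pd0 sdE]]; split=> //; split=> [z zs'|v].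
  by apply: pd0; apply: contraNN zs'; exact: ss.
rewrite sdE [RHS](bigID (mem s)) /= [X in _ + X]big1 ?addr0 => [|z /pd0 ->]; last by rewrite mulr0.
rewrite -[RHS]big_filter; apply/perm_big/uniq_perm; rewrite ?filter_uniq // => z.
by rewrite mem_filter andb_idr //; exact: ss.
Qed.

Lemma spansP f : exists s, spans s f.
Proof.
elim/(mono_ind S): f => [f g [s sf] [t tg]|c k].
  have us : uniq (undup (s ++ t)) by exact: undup_uniq.
  have [|_ [f0 fE]] := spansW us _ sf; first by move=> z zs; rewrite mem_undup mem_cat zs.
  have [|_ [g0 gE]] := spansW us _ tg; first by move=> z zs; rewrite mem_undup mem_cat zs orbT.
  exists (undup (s ++ t)); split=> //; split=> [z zs|v].
    by rewrite raddfD /= f0 // g0 // addr0.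
  rewrite raddfD /= fE gE -big_split; apply: eq_bigr => z _ /=.
  by rewrite raddfD /= mulrDr.
pose s1 : seq (fld * mi) := [seq (Viel mu m, 0 : mi) | mu <- enum 'I_d, m <- enum 'I_d].
pose s2 : seq (fld * mi) := [seq xjet x | x <- finsupp k.1].
pose s3 : seq (fld * mi) := [seq (Gh y.1, y.2) | y <- k.2].
have u1 : uniq s1.
  apply: allpairs_uniq; rewrite ?enum_uniq // => -[a b] [a' b'] _ _ /= [-> ->] //.
have u2 : uniq s2 by rewrite map_inj_uniq ?fset_uniq //; exact: xjet_inj.
have u3 : uniq s3 by rewrite map_inj_uniq ?fset_uniq // => -[a b] [a' b'] /= [-> ->].
exists (s1 ++ s2 ++ s3); split; last split=> [z|v].
- rewrite !cat_uniq u1 u2 u3 /= andbT; apply/andP; split; apply/hasPn => z.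
    rewrite mem_cat => /orP[/mapP[x _ ->]|/mapP[y _ ->]]; apply/negP => /allpairsP[[a b] /= [_ _]] //.
    by case: x => [[[mu m] J]|[x J]] // [_ _ J0]; have := valP J; rewrite /= J0 eqxx.
  move=> /mapP[y _ ->]; apply/negP => /mapP[x _]; by case: x => [[[mu m] J]|[x J]].
- case: (jet_kindP z) => [mu m|x|y] h; move: h; rewrite !mem_cat.
  + by rewrite (allpairs_f (fun mu m => (Viel mu m, 0 : mi))) ?mem_enum.
  + rewrite (mem_map xjet_inj) => h.
    have : x \notin finsupp k.1 by apply: contra h => ->; rewrite orbT.
    by rewrite -cmE_eq0 => /eqP xk; rewrite pderiv_even evend_sterm xk mulr0n sterm0.
  + move=> h; rewrite pderiv_odd oddd_sterm ifN //; apply: contra h => yk.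
    by rewrite [_ \in s3](map_f (fun y : yg => (Gh y.1, y.2)) yk) !orbT.
- rewrite asuperder_mono !big_cat /= addrA; congr (_ + _ + _); [|by rewrite big_map..].
  by rewrite big_allpairs_dep big_enum; apply: eq_bigr => mu _; rewrite big_enum.
Qed.

Lemma spans_seq (fs : seq A) : exists s, forall f, f \in fs -> spans s f.
Proof.
elim: fs => [|f fs [s IH]]; first by exists [::].
have [t tf] := spansP f; exists (undup (s ++ t)) => g.
have us : uniq (undup (s ++ t)) by exact: undup_uniq.
rewrite inE => /orP[/eqP ->|/IH]; [move: tf|]; apply: spansW => // z zs;
  by rewrite mem_undup mem_cat zs ?orbT.
Qed.

(** The hypothesis says that [v phi I] has parity [p] plus the parity of [phi], expressed through
    its commutation with every [f]. *)
Lemma asuperder_superderivation v p :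
  (forall phi I f, v phi I * parityX S (is_odd phi) f = parityX S p f * v phi I) ->
  superderivation S p (asuperder v).
Proof.
move=> vp; split=> [|f g]; first exact: asuperder_is_zmod_morphism.
have [s hs] := spans_seq [:: f; g; f * g].
have [|_ [_ ->]] := hs (f * g); first by rewrite !inE eqxx !orbT.
have [|_ [_ ->]] := hs f; first by rewrite !inE eqxx.
have [|_ [_ ->]] := hs g; first by rewrite !inE eqxx !orbT.
rewrite mulr_suml mulr_sumr -big_split; apply: eq_bigr => z _ /=.
by rewrite pderivM mulrDr !mulrA vp.
Qed.

(** A coefficient is even and central, so the Leibniz rule holds here for a [v] of no definite
    parity. It is applied to variations along arbitrary vector fields. *)
Lemma asuperder_scstM v c f : asuperder v (scst S c * f) = asuperder v (scst S c) * f + scst S c * asuperder v f.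
Proof.
have [s hs] := spans_seq [:: scst S c; f; scst S c * f].
have [|_ [_ ->]] := hs (scst S c * f); first by rewrite !inE eqxx !orbT.
have [|_ [_ ->]] := hs (scst S c); first by rewrite !inE eqxx.
have [|_ [_ ->]] := hs f; first by rewrite !inE eqxx !orbT.
rewrite mulr_suml mulr_sumr -big_split; apply: eq_bigr => z _ /=.
by rewrite pderivM parityX_scst mulrDr !mulrA (scstC S c (v _ _)).
Qed.

Lemma eq_asuperder v v' f : (forall phi I, pderiv (phi, I) f != 0 -> v phi I = v' phi I) ->
  asuperder v f = asuperder v' f.
Proof.
move=> vv; have [s [_ [_ sE]]] := spansP f; rewrite !sE; apply: eq_bigr => -[phi I] _ /=.
by have [->|/vv ->] := eqVneq (pderiv (phi, I) f) 0; rewrite ?mulr0.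
Qed.

Lemma asuperder_scst v c :
  asuperder v (scst S c) = \sum_mu \sum_m v (Viel mu m) 0 * scst S (mps_deriv (mxvec_index mu m) c).
Proof.
rewrite asuperder_mono /= big_seq_fset0 addr0 mdom1 big_seq_fset0 addr0.
by apply: eq_bigr => mu _; apply: eq_bigr => m _; rewrite pderiv_vielbein coefd_sterm.
Qed.

Lemma asuperder_jet v phi I : asuperder v (ajet phi I) = v phi I.
Proof.
have [s [us [s0 ->]]] := spansP (ajet phi I).
have ps : (phi, I) \in s.
  by apply: contraT => /s0 /eqP; rewrite pderiv_jet eqxx mulr1n oner_eq0.
rewrite (bigD1_seq (phi, I)) //= pderiv_jet eqxx mulr1 big1 ?addr0 // => z zne.
by rewrite pderiv_jet (negbTE zne) mulr0.
Qed.

(** * Total derivatives and their commutators with partial derivatives *)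

Definition atder (mu : 'I_d) : A -> A := asuperder (fun phi I => ajet phi (I + munit mu)).

Lemma parityK f : parity S (parity S f) = f.
Proof.
elim/(mono_ind S): f => [f g|c k]; first by rewrite !raddfD /= => -> ->.
by rewrite !parity_sterm mulrA -expr2 sqrr_sign mul1r.
Qed.

Lemma parity_jet phi I : parity S (ajet phi I) = (-1) ^+ is_odd phi * ajet phi I.
Proof.
have -> : ajet phi I = ajet (phi, I).1 (phi, I).2 by [].
have -> : is_odd phi = is_odd (phi, I).1 by [].
case: (jet_kindP (phi, I)) => [mu m|x|y].
- by rewrite /= -/(ajet (Viel mu m) 0) ajet_vielbein parity_scst mul1r.
- by rewrite ajet_even is_odd_xjet parity_evengen mul1r.
- by rewrite /= parity_oddgen mulN1r.
Qed.

Lemma jetC phi I f : ajet phi I * parityX S (is_odd phi) f = f * ajet phi I.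
Proof.
have -> : ajet phi I = ajet (phi, I).1 (phi, I).2 by [].
have -> : is_odd phi = is_odd (phi, I).1 by [].
case: (jet_kindP (phi, I)) => [mu m|x|y].
- by rewrite /= -/(ajet (Viel mu m) 0) ajet_vielbein scstC.
- by rewrite ajet_even is_odd_xjet evengenC.
- by rewrite /= oddgenC parityK.
Qed.

Arguments ajet : simpl never.

Lemma jet_ind (P : A -> Prop) :
  (forall f g, P f -> P g -> P (f + g)) -> (forall c, P (scst S c)) ->
  (forall phi I f, P f -> P (ajet phi I * f)) -> forall f, P f.
Proof.
move=> PD Pc Pj; apply: (superalg_ind (S := S)) => // [x|y] f Pf.
  by rewrite -ajet_even; exact: Pj.
by case: y => y I; exact: (Pj (Gh y) I f Pf).
Qed.

Lemma atder_superderivation mu : superderivation S false (atder mu).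
Proof. by apply: asuperder_superderivation => phi I f; exact: jetC. Qed.

Lemma atderM mu f g : atder mu (f * g) = atder mu f * g + f * atder mu g.
Proof. by case: (atder_superderivation mu). Qed.

HB.instance Definition _ mu := GRing.isZmodMorphism.Build A A (atder mu)
  (asuperder_is_zmod_morphism _).

Lemma atder_jet mu phi I : atder mu (ajet phi I) = ajet phi (I + munit mu).
Proof. exact: asuperder_jet. Qed.

Local Notation vp p := (Viel p.1 p.2).
Local Notation dp p := (mps_deriv (mxvec_index p.1 p.2)).

Lemma asuperder_scst_pair v c : asuperder v (scst S c) = \sum_p v (vp p) 0 * scst S (dp p c).
Proof. by rewrite asuperder_scst pair_bigA. Qed.

Lemma atder_scst mu c : atder mu (scst S c) =
  \sum_p ajet (vp p) (munit mu) * scst S (dp p c).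
Proof. by rewrite /atder asuperder_scst_pair; apply: eq_bigr => p _; rewrite add0r. Qed.

Lemma pderiv_asuperder z f : pderiv z f = asuperder (fun phi I => (z == (phi, I))%:R) f.
Proof.
have [s [us [s0 ->]]] := spansP f; have [zs|zs] := boolP (z \in s).
  rewrite (bigD1_seq z) //= -surjective_pairing eqxx mul1r big1 ?addr0 // => w wz.
  by rewrite -surjective_pairing eq_sym (negbTE wz) mul0r.
rewrite s0 // big_seq big1 // => w ws; rewrite -surjective_pairing.
by case: eqP => [E|_]; rewrite ?mul0r //; move: ws; rewrite -E (negbTE zs).
Qed.

Lemma pderiv_scst_pair z c : pderiv z (scst S c) = \sum_p scst S (dp p c) *+ (z == (vp p, 0)).
Proof.
by rewrite pderiv_asuperder asuperder_scst_pair; apply: eq_bigr => p _; rewrite mulr_natl.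
Qed.

Lemma atder_nat mu n : atder mu n%:R = 0.
Proof.
have -> : n%:R = scst S n%:R by rewrite rmorph_nat.
rewrite atder_scst big1 // => p _.
by rewrite raddfMn /= mps_deriv1 mul0rn rmorph0 mulr0.
Qed.

Lemma atder_sign mu (b : bool) f : atder mu ((-1) ^+ b * f) = (-1) ^+ b * atder mu f.
Proof. by case: b; rewrite ?mul1r // !mulN1r raddfN. Qed.

Lemma atder_parity mu f : atder mu (parity S f) = parity S (atder mu f).
Proof.
elim/jet_ind: f => [f g|c|phi I f IH].
- by rewrite !raddfD /= => -> ->.
- rewrite parity_scst atder_scst raddf_sum; apply: eq_bigr => q _ /=.
  by rewrite rmorphM /= parity_jet mul1r parity_scst.
- rewrite rmorphM /= parity_jet -mulrA atder_sign !atderM IH !raddfD /= !rmorphM /=.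
  by rewrite atder_jet !parity_jet -!mulrA mulrDr.
Qed.

Lemma commutator_jet p D E mu :
  superderivation S p D -> superderivation S p E ->
  (forall c, D (atder mu (scst S c)) = atder mu (D (scst S c)) + E (scst S c)) ->
  (forall phi I, D (atder mu (ajet phi I)) = atder mu (D (ajet phi I)) + E (ajet phi I)) ->
  forall f, D (atder mu f) = atder mu (D f) + E f.
Proof.
move=> hD hE hc hj; apply: (commutator_gen hD hE (atder_superderivation mu)) => //.
- exact: atder_parity.
- by move=> x; rewrite -ajet_even.
- by move=> [y I]; exact: (hj (Gh y) I).
Qed.

Lemma zero_superderivation p : superderivation S p (fun=> 0).
Proof. by split=> [f g|f g]; rewrite ?subrr // mul0r mulr0 addr0. Qed.

Lemma addmUE mu nu I : (I + munit mu) nu = (I nu + (nu == mu))%N.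
Proof. by rewrite !ffunE. Qed.
Lemma addmUU mu I : (I + munit mu) mu = (I mu).+1.
Proof. by rewrite addmUE eqxx addn1. Qed.

Lemma addmU_inj mu I J : I + munit mu = J + munit mu -> I = J.
Proof.
move/ffunP => E; apply/ffunP => nu; have := E nu.
by rewrite !ffunE => /addIn.
Qed.

Lemma atder_comm mu nu f : atder mu (atder nu f) = atder nu (atder mu f).
Proof.
rewrite -[RHS]addr0; apply: (commutator_jet (atder_superderivation mu)
   (zero_superderivation _)) => [c|phi I]; rewrite addr0; last first.
  by rewrite !atder_jet addrAC.
rewrite !atder_scst !raddf_sum /=.
have vC p q I J : ajet (vp p) I * ajet (vp q) J = ajet (vp q) J * ajet (vp p) I.
  exact: (@jetC (vp p) I (ajet (vp q) J)).
under eq_bigr do rewrite atderM atder_jet atder_scst mulr_sumr.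
under [RHS]eq_bigr do rewrite atderM atder_jet atder_scst mulr_sumr.
rewrite !big_split /=; congr (_ + _); first by apply: eq_bigr => p _; rewrite addrC.
rewrite exchange_big; apply: eq_bigr => p _; apply: eq_bigr => q _ /=.
by rewrite !mulrA vC mps_deriv_comm.
Qed.

Lemma addmU_eq mu (phi psi : fld) I J :
  ((phi, I + munit mu) == (psi, J + munit mu)) = ((phi, I) == (psi, J)).
Proof. by apply/eqP/eqP => [[-> /addmU_inj ->]|[-> ->]]. Qed.

Lemma addmU_neq0 mu I : I + munit mu != 0.
Proof.
by apply/eqP => /ffunP /(_ mu); rewrite addmUU ffunE.
Qed.

Lemma pderiv_atder_scst mu z c : pderiv z (atder mu (scst S c)) =
  \sum_p scst S (dp p c) *+ (z == (vp p, munit mu)) +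
  \sum_p ajet (vp p) (munit mu) * pderiv z (scst S (dp p c)).
Proof.
rewrite atder_scst raddf_sum -big_split; apply: eq_bigr => p _ /=.
rewrite pderivM pderiv_jet mulr_natl; congr (_ + _ * _).
by case: is_odd => //=; rewrite parity_jet mul1r.
Qed.

(** Both sides are determined by coefficients and jets. On jets, the shift by [munit mu] is
    injective, so [(phi, I + munit mu)] arises from [(phi, I)] alone. *)
Lemma pderiv_atder mu phi I f :
  pderiv (phi, I + munit mu) (atder mu f) =
  atder mu (pderiv (phi, I + munit mu) f) + pderiv (phi, I) f.
Proof.
move: f; apply: (@commutator_jet (is_odd phi)); try exact: pderiv_superderivation.
  have pd0 c : pderiv (phi, I + munit mu) (scst S c) = 0.
    rewrite pderiv_scst_pair big1 // => p _; case: eqP => // -[_ /eqP].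
    by rewrite (negbTE (addmU_neq0 _ _)).
  move=> c; rewrite pd0 raddf0 add0r pderiv_atder_scst [X in _ + X]big1 => [|p _].
    rewrite addr0 pderiv_scst_pair; apply: eq_bigr => p _.
    by rewrite -[in RHS](addmU_eq mu) add0r.
  by rewrite pd0 mulr0.
by move=> psi J; rewrite atder_jet !pderiv_jet atder_nat add0r addmU_eq.
Qed.

(** A coordinate without a derivative in direction [mu] never arises from [atder mu], so the extra
    term of [pderiv_atder] is absent. *)
Lemma pderiv_atder0 mu phi I f : I mu = 0%N ->
  pderiv (phi, I) (atder mu f) = atder mu (pderiv (phi, I) f).
Proof.
move=> I0; rewrite -[RHS]addr0; move: f; apply: (@commutator_jet (is_odd phi)).
- exact: pderiv_superderivation.
- exact: zero_superderivation.
- move=> c; rewrite addr0 pderiv_atder_scst big1 ?add0r => [|p _]; last first.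
    case: eqP => // -[_ E]; move: I0; rewrite E ffunE eqxx //.
  rewrite pderiv_scst_pair raddf_sum /=.
  under eq_bigr do rewrite pderiv_scst_pair mulr_sumr.
  rewrite exchange_big; apply: eq_bigr => q _ /=.
  rewrite raddfMn /= atder_scst -sumrMnl; apply: eq_bigr => p _.
  by rewrite mulrnAr mps_deriv_comm.
- move=> psi J; rewrite addr0 atder_jet !pderiv_jet atder_nat.
  case: eqP => // -[_ E]; by move: I0; rewrite E addmUU.
Qed.

(* A functional annihilated by [atder mu] has no jet coordinate [I] with [I mu]
   maximal, since [pderiv (phi, I) f = [pderiv (phi, I + munit mu), atder mu] f]. *)
Lemma atder_eq0_pderiv mu f : atder mu f = 0 -> forall z, pderiv z f = 0.
Proof.
move=> tf0; have [s [_ [s0 _]]] := spansP f.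
suff H n phi I : (n <= I mu)%N -> pderiv (phi, I) f = 0.
  by case=> phi I; exact: (H 0%N).
pose B := (\max_(z <- s) z.2 mu).+1.
have hB : forall phi I, (B <= I mu)%N -> pderiv (phi, I) f = 0.
  move=> psi J ltJ; apply: s0; apply: contraL ltJ => zs; rewrite -ltnNge ltnS.
  exact: (@leq_bigmax_seq _ s xpredT (fun z : fld * mi => z.2 mu) (psi, J)).
have [k] : exists k, (B <= n + k)%N by exists B; rewrite leq_addl.
elim: k n phi I => [|k IH] n phi I; first by rewrite addn0 => /leq_trans h /h /hB.
rewrite addnS -addSn => /IH {}IH leI.
have := pderiv_atder mu phi I f; rewrite tf0 raddf0 (IH phi (I + munit mu)); last by rewrite addmUU.
by rewrite raddf0 add0r.
Qed.

Lemma mps_mulrnE (c : L) n m : (c *+ n) m = c m *+ n.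
Proof. by elim: n => [|n IH] //; rewrite !mulrS mpsD IH. Qed.

Lemma coef_coefd (D : L -> L) k f : zmod_morphism D ->
  coef S k (coefd S D f) = D (coef S k f).
Proof.
move=> DB; have CB := coefdB S DB; elim/(mono_ind S): f => [f g|c l].
  by rewrite (zmod_morphD CB) !raddfD /= (zmod_morphD DB) => -> ->.
rewrite coefd_sterm // !coef_mono; case: eqP => // _; exact/esym/zmod_morph0.
Qed.

(** A monomial other than the unit contains a generator, and its coefficient is, up to a sign or a
    nonzero integer, a coefficient of the partial derivative by it. What remains is a series with
    vanishing derivatives; characteristic 0 makes it constant. *)
Lemma pderiv_eq0_const f : (forall z, pderiv z f = 0) -> exists c : K, f = scst S (mpsC c).
Proof.
move=> f0; pose c := coef S (sone _ _) f.
have ck k : k != sone _ _ -> coef S k f = 0.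
  case: k => m T k1; have [T0|[y yT]] := fset_0Vmem T.
    have [m1|[x xm]] := fset_0Vmem (finsupp m).
      case/eqP: k1; rewrite T0; congr (_, _).
      by apply/eqP/cmP => i; rewrite cm1; apply/eqP; rewrite cmE_eq0 m1 in_fset0.
    have := coef_evend S x f (divcm m (ucm x), T); rewrite -pderiv_even f0 raddf0 /=.
    have <- : m = mmul (ucm x) (divcm m (ucm x)).
      apply/eqP/cmP => i; rewrite cmM divcmE ucmE; case: eqP => [<-|]; last by rewrite subn0.
      by rewrite subnKC // lt0n cmE_neq0.
    move=> E; apply/funext => q; have /eqP := congr1 (fun g : L => g q) E.
    by rewrite mps_mulrnE eq_sym mulrn_eq0 => /eqP.
  have := @coef_oddd _ _ _ _ S y f (m, (T `\ y)%fset); rewrite /= in_fsetD1 eqxx => /(_ isT).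
  rewrite -pderiv_odd f0 raddf0 fsetD1K // => /esym E.
  by rewrite -[LHS]mul1r -(sqrr_sign _ (ninv [fset y]%fset T)) expr2 -mulrA E mulr0.
have dc i : mps_deriv i c = 0.
  case/mxvec_indexP: i => mu m.
  by rewrite -(coef_coefd _ _ (dB _)) -pderiv_vielbein f0 raddf0.
have [a ca] := mps_deriv_eq0 dc; exists a; rewrite -ca; apply: (coef_ext S) => k.
rewrite coef_mono; case: eqP => [<-//|/eqP k1]; by rewrite ck // eq_sym.
Qed.

(** * Iterated total derivatives and the Euler operator *)

Definition aiterD (T : Type) (D : 'I_d -> T -> T) I (x : T) : T :=
  foldr (fun mu => iter (I mu) (D mu)) x (enum 'I_d).

(** [aiterD] runs through the directions in a fixed order; commutation of the [D mu] lets the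
    additional one be pulled to the front. *)
Lemma aiterDU (T : Type) (D : 'I_d -> T -> T) mu I x :
  (forall mu nu y, D mu (D nu y) = D nu (D mu y)) ->
  aiterD D (I + munit mu) x = D mu (aiterD D I x).
Proof.
move=> DC; rewrite /aiterD.
have itC nu n y : iter n (D nu) (D mu y) = D mu (iter n (D nu) y).
  by elim: n => //= n ->.
have notin (r : seq 'I_d) : mu \notin r -> foldr (fun nu => iter ((I + munit mu)%R nu) (D nu)) x r =
    foldr (fun nu => iter (I nu) (D nu)) x r.
  elim: r => //= nu r IH; rewrite inE => /norP[/negbTE munu /IH ->].
  by rewrite addmUE eq_sym munu addn0.
have : mu \in enum 'I_d by rewrite mem_enum.
elim: (enum 'I_d) (enum_uniq 'I_d) => //= nu r IH /andP[nur ur].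
rewrite inE => /orP[/eqP E|mur].
  by subst nu; rewrite notin // addmUU.
rewrite IH // itC; congr (D mu (iter _ _ _)).
by rewrite addmUE; case: eqP mur nur => [-> -> //|_ _ _]; rewrite addn0.
Qed.

Lemma aiterD0 (T : Type) (D : 'I_d -> T -> T) x : aiterD D 0 x = x.
Proof. by rewrite /aiterD; elim: (enum _) => //= mu r ->; rewrite ffunE. Qed.

Definition mweight I := (\sum_mu I mu)%N.

Lemma mweightU mu I : mweight (I + munit mu) = (mweight I).+1.
Proof.
rewrite /mweight (eq_bigr (fun nu => I nu + (nu == mu))%N); last first.
  by move=> nu _; exact: addmUE.
rewrite big_split /= (bigD1 mu (F := fun nu => nat_of_bool _)) //= eqxx.
by rewrite [X in (1 + X)%N]big1 ?addn1 // => nu /negbTE ->.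
Qed.

Lemma aiterD_is_zmod_morphism I : zmod_morphism (aiterD atder I : A -> A).
Proof.
move=> f g; rewrite /aiterD; elim: (enum _) => //= mu r ->.
by elim: (I mu) => //= n ->; rewrite raddfB.
Qed.
HB.instance Definition _ I := GRing.isZmodMorphism.Build A A (aiterD atder I)
  (aiterD_is_zmod_morphism I).

Lemma aiterD_atderU mu I f : aiterD atder (I + munit mu) f = atder mu (aiterD atder I f).
Proof. by apply: aiterDU; exact: atder_comm. Qed.

Lemma aiterD_atder mu I f : aiterD atder I (atder mu f) = atder mu (aiterD atder I f).
Proof.
rewrite /aiterD; elim: (enum _) => //= nu r ->.
by elim: (I nu) => //= n ->; exact: atder_comm.
Qed.

Lemma big_uniq_subset (T : eqType) (r s : seq T) (h : T -> A) : uniq r -> uniq s ->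
  {subset r <= s} -> (forall x, x \notin r -> h x = 0) ->
  \sum_(x <- s) h x = \sum_(x <- r) h x.
Proof.
move=> ur us rs h0; rewrite (bigID (mem r)) /= [X in _ + X]big1 ?addr0; last first.
  by move=> x; exact: h0.
rewrite -[LHS]big_filter; apply/perm_big/uniq_perm; rewrite ?filter_uniq // => x.
by rewrite mem_filter andb_idr //; exact: rs.
Qed.

(** The variational derivative by [phi], cut to a finite list of multi-indices. *)
Definition euler (s : seq mi) (phi : fld) f :=
  \sum_(I <- s) (-1) ^+ mweight I * aiterD atder I (pderiv (phi, I) f).

(** The commutator [g] of partial and total derivative is supported on the shift of [r] by
    [munit mu]. The sum over [r] and the sum over its shift then agree term by term up to sign, as
    the shift raises the order by one. *)
Lemma euler_atder phi mu f (r s : seq mi) : uniq r -> uniq s -> {subset r <= s} ->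
    (forall I, I \in r -> I + munit mu \in s) ->
    (forall I, I \notin r -> pderiv (phi, I) f = 0) ->
  euler s phi (atder mu f) = 0.
Proof.
move=> ur us rs rUs pd0.
pose g I := pderiv (phi, I) (atder mu f) - atder mu (pderiv (phi, I) f).
have gU I : g (I + munit mu) = pderiv (phi, I) f by rewrite /g pderiv_atder addrC addKr.
have urU : uniq [seq I1 + munit mu | I1 <- r] by rewrite map_inj_uniq //; exact: addmU_inj.
have g0 I : I \notin [seq I1 + munit mu | I1 <- r] -> g I = 0.
  move=> Ir; have [I0|I0] := posnP (I mu); first by rewrite /g pderiv_atder0 ?subrr.
  have E : I = [ffun nu => (I nu - (nu == mu))%N] + munit mu.
    apply/ffunP => nu; rewrite addmUE ffunE; case: eqP => [->|_]; last by rewrite subn0 addn0.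
    by rewrite subnK.
  rewrite E gU pd0 //; apply: contraNN Ir => h; rewrite E; exact: map_f.
rewrite /euler (eq_bigr (fun I => (-1) ^+ mweight I * atder mu (aiterD atder I (pderiv (phi, I) f))
    + (-1) ^+ mweight I * aiterD atder I (g I))); last first.
  by move=> I _; rewrite -mulrDr -aiterD_atder -raddfD /= /g addrC subrK.
rewrite big_split /= (big_uniq_subset ur us) //; last first.
  by move=> I /pd0 ->; rewrite !raddf0 mulr0.
rewrite (big_uniq_subset urU us) //; last by move=> I /g0 ->; rewrite raddf0 mulr0.
  rewrite big_map -big_split /=; apply: big1 => I _.
  by rewrite gU mweightU aiterD_atderU exprS mulN1r mulNr subrr.
by move=> _ /mapP[I /rUs h ->].
Qed.

(* The Euler operator kills total derivatives and extracts the coefficient of an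
   undifferentiated field entering linearly. *)
Lemma linear_total_derivative (phis : 'I_d -> fld) (G J : 'I_d -> A) :
  injective phis -> (forall sg tau I, pderiv (phis tau, I) (G sg) = 0) ->
  \sum_sg ajet (phis sg) 0 * G sg = \sum_mu atder mu (J mu) -> forall sg, G sg = 0.
Proof.
move=> phi_inj G0 E tau; pose phi := phis tau.
have [t ht] := spans_seq [seq J mu | mu <- enum 'I_d].
pose r := undup [seq z.2 | z <- t].
(* [r] collects the multi-indices on which the [J mu] can depend; [s] adds their shifts, as
   [euler_atder] requires, and the index 0 at which [G tau] is extracted. *)
pose s := undup ((0 : mi) :: r ++ [seq I1 + munit mu | I1 <- r, mu <- enum 'I_d]).
have J0 mu I : I \notin r -> pderiv (phi, I) (J mu) = 0.
  have [|_ [pd0 _]] := ht (J mu); first by apply: map_f; rewrite mem_enum.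
  move=> Ir; apply: pd0; apply: contraNN Ir => h; rewrite mem_undup.
  exact: (map_f (fun z : fld * mi => z.2) h).
have E0 : euler s phi (\sum_sg ajet (phis sg) 0 * G sg) = 0.
  rewrite E /euler; under eq_bigr do rewrite !raddf_sum mulr_sumr /=.
  rewrite exchange_big big1 //= => mu _.
  apply: (@euler_atder phi mu (J mu) r) => //; rewrite ?undup_uniq //; last exact: J0.
    by move=> I Ir; rewrite mem_undup inE mem_cat Ir orbT.
  move=> I Ir; rewrite mem_undup inE mem_cat (allpairs_f (fun (I : mi) mu => I + munit mu)) ?orbT //.
  by rewrite mem_enum.
have lin I : pderiv (phi, I) (\sum_sg ajet (phis sg) 0 * G sg) = G tau *+ (I == 0).
  rewrite raddf_sum (bigD1 tau) //= big1 => [|sg sgne]; rewrite pderivM G0 mulr0 addr0 pderiv_jet.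
    by rewrite addr0 mulr_natl; congr (_ *+ _); rewrite -pair_eqE /= eqxx.
  rewrite -pair_eqE /= (inj_eq phi_inj) eq_sym (negbTE sgne) /= mulr0n mul0r //.
rewrite -E0 /euler (bigD1_seq 0) ?undup_uniq ?mem_undup ?inE ?eqxx //=.
rewrite lin eqxx aiterD0 big1 => [|I /negbTE I0]; last by rewrite lin I0 raddf0 mulr0.
rewrite addr0 /mweight big1 ?mul1r // => mu _; exact: ffunE.
Qed.
End JetCalculus.

(** * Expressions linear in a vector field *)

Section LinearRepresentation.
Variables (d : nat) (A : nzRingType).
Local Notation mi := (mindex d).
Local Notation vec := ('I_d -> mi -> A).
Local Notation term := ('I_d * mi * A)%type.
Implicit Types (X : vec) (l : seq term) (F : vec -> A).

(* Expressions linear in the jet of a vector field are handled through their list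
   of coefficients, so that a vector field with real components can be replaced
   by one whose components are odd functionals. *)
Definition ev X l : A := \sum_(e <- l) X e.1.1 e.1.2 * e.2.

Definition linrep F := exists l, forall X, F X = ev X l.

Lemma ev_cat X l1 l2 : ev X (l1 ++ l2) = ev X l1 + ev X l2.
Proof. exact: big_cat. Qed.

Lemma linrep_jet rho I : linrep (fun X => X rho I).
Proof. by exists [:: (rho, I, 1)] => X; rewrite /ev big_seq1 mulr1. Qed.

Lemma linrepD F1 F2 : linrep F1 -> linrep F2 -> linrep (fun X => F1 X + F2 X).
Proof. by move=> [l1 E1] [l2 E2]; exists (l1 ++ l2) => X; rewrite ev_cat E1 E2. Qed.

Lemma linrepN F : linrep F -> linrep (fun X => - F X).
Proof.
move=> [l E]; exists [seq (e.1, - e.2) | e <- l] => X.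
by rewrite E /ev big_map -sumrN; apply: eq_bigr => e _; rewrite mulrN.
Qed.

Lemma linrepB F1 F2 : linrep F1 -> linrep F2 -> linrep (fun X => F1 X - F2 X).
Proof. by move=> h1 /linrepN; exact: linrepD. Qed.

Lemma linrep_sum (T : Type) (r : seq T) (F : T -> vec -> A) :
  (forall i, linrep (F i)) -> linrep (fun X => \sum_(i <- r) F i X).
Proof.
move=> h; elim: r => [|i r [l E]].
  by exists [::] => X; rewrite big_nil /ev big_nil.
by have [l' E'] := h i; exists (l' ++ l) => X; rewrite big_cons E E' ev_cat.
Qed.

Lemma linrepMr F c : linrep F -> linrep (fun X => F X * c).
Proof.
move=> [l E]; exists [seq (e.1, e.2 * c) | e <- l] => X.
by rewrite E /ev big_map mulr_suml; apply: eq_bigr => e _; rewrite mulrA.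
Qed.

Lemma linrepMl c F : (forall a, c * a = a * c) -> linrep F -> linrep (fun X => c * F X).
Proof.
move=> cC /(linrepMr c)[l E]; exists l => X; rewrite -E; exact: cC.
Qed.

Lemma evMl c X l : ev (fun rho I => c * X rho I) l = c * ev X l.
Proof. by rewrite /ev mulr_sumr; apply: eq_bigr => e _; rewrite mulrA. Qed.

Section Prolongation.
Variable t : 'I_d -> A -> A.
Hypothesis tB : forall mu, zmod_morphism (t mu).
Hypothesis tM : forall mu a b, t mu (a * b) = t mu a * b + a * t mu b.

(** The coefficient list of a total derivative, by the Leibniz rule: either the coefficient is
    differentiated or the jet of the vector field is raised. *)
Definition prolong mu l : seq term :=
  [seq (e.1, t mu e.2) | e <- l] ++ [seq (e.1.1, e.1.2 + munit mu, e.2) | e <- l].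

Lemma t_sum mu (T : Type) (r : seq T) (F : T -> A) :
  t mu (\sum_(i <- r) F i) = \sum_(i <- r) t mu (F i).
Proof. exact: (big_morph (t mu) (zmod_morphD (tB mu)) (zmod_morph0 (tB mu))). Qed.

Lemma t_ev mu X l : (forall rho I, t mu (X rho I) = X rho (I + munit mu)) ->
  t mu (ev X l) = ev X (prolong mu l).
Proof.
move=> tX; rewrite ev_cat /ev !big_map t_sum -big_split; apply: eq_bigr => e _ /=.
by rewrite tM tX addrC.
Qed.

Lemma aiterD_ev I X l : (forall mu rho J, t mu (X rho J) = X rho (J + munit mu)) ->
  aiterD t I (ev X l) = ev X (aiterD prolong I l).
Proof.
move=> tX; rewrite /aiterD; elim: (enum _) => //= mu r ->.
by elim: (I mu) => //= n ->; exact: t_ev.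
Qed.

Variables (B : nzRingType) (emb : B -> A).
Hypotheses (emb0 : emb 0 = 0) (emb1 : emb 1 = 1) (temb : forall mu b, t mu (emb b) = 0).
Local Notation bvec := ('I_d -> mi -> B).
Definition embv (xi : bvec) : vec := fun rho I => emb (xi rho I).

Definition xt mu (F : bvec -> A) (xi : bvec) : A :=
  t mu (F xi) + F (fun rho I => xi rho (I + munit mu)).

(** Real jets are constants for [t], and [xt] shifts them explicitly; for functionals, as in
    [aiterD_ev], [t] itself shifts the jets. Both cases yield the same coefficient list, which is
    what allows the one to be replaced by the other. *)
Lemma aiterD_xt_ev I l :
  aiterD xt I (fun xi => ev (embv xi) l) = fun xi => ev (embv xi) (aiterD prolong I l).
Proof.
rewrite /aiterD; elim: (enum _) => //= mu r ->.
elim: (I mu) => //= n ->; apply/funext => xi; rewrite /xt ev_cat /ev !big_map t_sum.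
by congr (_ + _); apply: eq_bigr => e _ /=; rewrite tM temb mul0r add0r.
Qed.

(* Testing on vector fields with a single nonzero jet coordinate. *)
Lemma ev_eq0 l : (forall xi : bvec, ev (embv xi) l = 0) -> forall X, ev X l = 0.
Proof.
move=> h X; rewrite /ev.
have key z : \sum_(e <- l) e.2 *+ (e.1 == z) = 0.
  rewrite -[RHS](h (fun rho I => ((rho, I) == z)%:R)) /ev.
  apply: eq_bigr => e _; rewrite /embv -surjective_pairing.
  by case: eqP => _; rewrite ?emb1 ?emb0 ?mul1r ?mul0r.
transitivity (\sum_(e <- l) \sum_(z <- undup [seq e.1 | e <- l])
    X z.1 z.2 * (e.2 *+ (e.1 == z))).
  rewrite big_seq [RHS]big_seq; apply: eq_bigr => e el.
  rewrite (bigD1_seq e.1) ?undup_uniq ?mem_undup ?map_f //= eqxx big1 ?addr0 //.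
  by move=> z /negbTE; rewrite eq_sym => ->; rewrite mulr0.
rewrite exchange_big big1 //= => z _.
by rewrite -mulr_sumr key mulr0.
Qed.
End Prolongation.
End LinearRepresentation.

Section Covariance.
Variables (d N nH nS nI : nat) (K : numFieldType) (A : nzRingType).
Local Notation mi := (mindex d).
Local Notation fld := (field d N nH nS nI).
Variable S : supermonomials (mps (d * d) K) (xgen d N nH nS nI) (ygen d N) A.
Local Notation vec := ('I_d -> mi -> A).
Local Notation term := ('I_d * mi * A)%type.
Local Notation t := (atder S).
Variable l : fld -> seq term.

Definition lie_jets (X : vec) (phi : fld) I : A := ev X (aiterD (prolong t) I (l phi)).

Lemma asuperder_ev (h : fld -> mi -> seq term) f :
  linrep (fun X : vec => asuperder S (fun phi I => ev X (h phi I)) f).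
Proof.
have [s [_ [_ sE]]] := spansP S f.
have [L LE] : linrep (fun X => \sum_(z <- s) ev X (h z.1 z.2) * pderiv S z f).
  by apply: linrep_sum => z; apply: linrepMr; exists (h z.1 z.2).
by exists L => X; rewrite sE LE.
Qed.

Variables (B : nzRingType) (emb : B -> A).
Hypotheses (emb0 : emb 0 = 0) (emb1 : emb 1 = 1).

(** The difference of the two sides has a coefficient list with [X] on the left, and the embedded
    [xi] suffice to separate its coefficients. Nothing is assumed about the commutation of [X]. *)
Lemma covariance_extend f :
  (forall xi : 'I_d -> mi -> B, asuperder S (lie_jets (embv emb xi)) f =
     \sum_rho emb (xi rho 0) * t rho f) ->
  forall X, asuperder S (lie_jets X) f = \sum_rho X rho 0 * t rho f.
Proof.
move=> cov X; apply/eqP; rewrite -subr_eq0; apply/eqP.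
have [L LE] : linrep (fun X : vec => asuperder S (lie_jets X) f - \sum_rho X rho 0 * t rho f).
  apply: linrepB; first exact: asuperder_ev.
  by apply: linrep_sum => rho; apply: linrepMr; exact: linrep_jet.
by rewrite LE; apply: (ev_eq0 emb0 emb1) => xi; rewrite -LE cov subrr.
Qed.
End Covariance.

(** * Metric and density *)

Section Minkowski.
Variables (R : comNzRingType) (d : nat).

Lemma minkowski_diag :
  minkowski R d = diag_mx (\row_m if m == 0%N :> nat then -1 else 1).
Proof.
apply/matrixP => i j; rewrite !mxE; case: eqP => [->|ij] /=; first by rewrite mulr1n.
by rewrite mulr0n.
Qed.

Lemma det_minkowski : (0 < d)%N -> \det (minkowski R d) = -1.
Proof.
rewrite minkowski_diag det_diag; case: d => // d' _.
rewrite big_ord_recl mxE /= big1 ?mulr1 // => i _; by rewrite mxE.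
Qed.

Lemma minkowski_tr : (minkowski R d)^T = minkowski R d.
Proof. by rewrite minkowski_diag tr_diag_mx. Qed.

Lemma minkowski_sqr : minkowski R d *m minkowski R d = 1%:M.
Proof.
rewrite minkowski_diag mulmx_diag -diag_const_mx; congr diag_mx.
by apply/rowP => i; rewrite !mxE; case: eqP; rewrite ?mulrNN mulr1.
Qed.
End Minkowski.

Lemma map_minkowski (R1 R2 : nzRingType) (f : {rmorphism R1 -> R2}) d :
  map_mx f (minkowski R1 d) = minkowski R2 d.
Proof.
apply/matrixP => i j; rewrite !mxE.
by case: ifP; rewrite ?rmorph0 //; case: ifP; rewrite ?rmorphN1 ?rmorph1.
Qed.

Lemma mul_adj_inv (R : comNzRingType) n (M : 'M[R]_n) c : \det M * c = 1 ->
  M *m (c *: \adj M) = 1%:M /\ (c *: \adj M) *m M = 1%:M.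
Proof.
move=> cM; rewrite -scalemxAr -scalemxAl mul_mx_adj mul_adj_mx scale_scalar_mx.
by rewrite mulrC cM.
Qed.

Section Metric.
Variables (d N nH nS nI : nat) (K : numFieldType) (A : nzRingType).
Hypothesis d_gt0 : (0 < d)%N.
Local Notation mi := (mindex d).
Local Notation fld := (field d N nH nS nI).
Local Notation L := (mps (d * d) K).
Variable S : supermonomials L (xgen d N nH nS nI) (ygen d N) A.
Local Notation vec := ('I_d -> mi -> A).
Local Notation t := (atder S).
Local Notation sc := (scst S).
Local Notation Viel mu m := (Vielbein N nH nS nI mu m : fld).
Local Notation V := (@vielb d K).
Local Notation E := (minkowski L d).

Definition ametric : 'M[L]_d := V *m E *m V^T.
Local Notation g := ametric.

Lemma const_vielb : map_mx (@mps_const _ _) V = 1%:M.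
Proof.
by apply/matrixP => i j; rewrite !mxE rmorphD /= rmorph_nat mps_constX addr0.
Qed.

Lemma const_det_vielb : mps_const (\det V) = 1.
Proof. by rewrite -det_map_mx const_vielb det1. Qed.

(** At the flat background the vielbein is the identity and - det g is - det eta = 1. This is the
    condition under which the powers of - det g obey the laws of exponents. *)
Lemma const_det_metric : mps_const (- \det g) = 1.
Proof.
rewrite rmorphN 2!det_mulmx det_tr 2!rmorphM /= const_det_vielb mul1r mulr1.
by rewrite -det_map_mx map_minkowski det_minkowski // opprK.
Qed.

Lemma metric_tr : g^T = g.
Proof. by rewrite !trmx_mul trmxK minkowski_tr mulmxA. Qed.

Lemma metricC mu nu : g mu nu = g nu mu.
Proof. by rewrite -{1}metric_tr mxE. Qed.

Definition vielbV : 'M[L]_d := mps_pow (\det V) (-1) *: \adj V.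
Lemma mul_vielbV : V *m vielbV = 1%:M.
Proof.
by have [] // := @mul_adj_inv _ _ V (mps_pow (\det V) (-1)); rewrite mulrC mps_powN1 // const_det_vielb.
Qed.

Definition metricV : 'M[L]_d := - mps_pow (- \det g) (-1) *: \adj g.
Let metricV_inv : g *m metricV = 1%:M /\ metricV *m g = 1%:M.
Proof.
by apply: mul_adj_inv; rewrite mulrN -mulNr mulrC mps_powN1 // const_det_metric.
Qed.
Lemma mul_metricV : g *m metricV = 1%:M. Proof. by case: metricV_inv. Qed.
Lemma mul_Vmetric : metricV *m g = 1%:M. Proof. by case: metricV_inv. Qed.

Definition agl mu nu : A := sc (g mu nu).
Definition agu mu nu : A := sc (\adj g mu nu * - mps_pow (- \det g) (-1)).
Definition adensity (a : K) : A := sc (mps_pow (- \det g) a).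
Definition aeu mu m : A := \sum_n sc (mpsC (minkowski K d m n)) *
  sc (\adj V n mu * mps_pow (\det V) (-1)).

Lemma aguE mu nu : agu mu nu = sc (metricV mu nu).
Proof. by rewrite /agu [metricV _ _]mxE mulrC. Qed.

Lemma lower_raise (x : 'I_d -> A) nu :
  \sum_sg agl nu sg * (\sum_rho agu sg rho * x rho) = x nu.
Proof.
transitivity (\sum_rho sc ((g *m metricV) nu rho) * x rho).
  under eq_bigr do rewrite mulr_sumr.
  rewrite exchange_big; apply: eq_bigr => rho _ /=.
  rewrite mxE raddf_sum mulr_suml; apply: eq_bigr => sg _ /=.
  by rewrite aguE mulrA -rmorphM.
rewrite mul_metricV (bigD1 nu) //= mxE eqxx rmorph1 mul1r big1 ?addr0 // => rho.
by rewrite eq_sym => /negbTE ne; rewrite mxE ne rmorph0 mul0r.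
Qed.

Lemma aeuE mu m : aeu mu m = sc ((E *m vielbV) m mu).
Proof.
rewrite /aeu mxE raddf_sum; apply: eq_bigr => n _ /=.
rewrite [vielbV _ _]mxE -rmorphM -(map_minkowski (@mpsC (d * d) K)).
by rewrite [map_mx _ _ _ _]mxE; congr (sc (_ * _)); rewrite mulrC.
Qed.

Lemma asuperder_scst_deriv (v : fld -> mi -> A) a b :
  asuperder S v (sc (a * b)) = asuperder S v (sc a) * sc b + asuperder S v (sc b) * sc a.
Proof. by rewrite rmorphM /= asuperder_scstM (scstC _ _ (asuperder _ _ _)). Qed.

(** The power rule and Jacobi's formula in each power series variable, reassembled into variations
    of the metric. As [v] is arbitrary, [asuperder_density] uses this both for the variation and for
    the total derivative of the density. *)
Lemma asuperder_pow (v : fld -> mi -> A) a :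
  asuperder S v (adensity a) = \sum_i \sum_j asuperder S v (agl i j) *
    sc (\adj g j i * - (mpsC a * mps_pow (- \det g) (a - 1))).
Proof.
rewrite /adensity asuperder_scst_pair.
transitivity (\sum_p \sum_i \sum_j v (Viel p.1 p.2) 0 *
   sc (mps_deriv (mxvec_index p.1 p.2) (g i j)) *
   sc (\adj g j i * - (mpsC a * mps_pow (- \det g) (a - 1)))).
  apply: eq_bigr => p _; under eq_bigr do under eq_bigr do rewrite -mulrA -rmorphM.
  under eq_bigr do rewrite -mulr_sumr -raddf_sum /=.
  rewrite -mulr_sumr -raddf_sum /=; congr (_ * sc _).
  rewrite mps_deriv_pow ?const_det_metric // raddfN /=.
  rewrite (@derivation_det _ (mps_deriv (mxvec_index p.1 p.2))); last 2 first.
  - by move=> x y; exact: raddfD.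
  - exact: mps_derivM.
  rewrite mulrN -mulNr mulr_sumr; apply: eq_bigr => i _.
  by rewrite mulr_sumr; apply: eq_bigr => j _; ring.
rewrite exchange_big; apply: eq_bigr => i _; rewrite exchange_big; apply: eq_bigr => j _.
by rewrite -mulr_suml -asuperder_scst_pair.
Qed.

(** * Variation of the metric and of the density along a vector field *)

Section Variation.
Variables (h : K) (LM : 'I_d -> 'I_d -> A) (v : fld -> mi -> A).
Hypotheses (h2 : h + h = 1) (LMC : forall mu nu, LM mu nu = LM nu mu).
Hypothesis vE : forall mu m,
  v (Viel mu m) 0 = sc (mpsC h) * \sum_nu LM mu nu * aeu nu m.

(** Varying the two vielbeins in [V E V^T] gives [h] times [LM mu nu] and [h] times [LM nu mu],
    which add up to [LM mu nu] by symmetry and [h2]. *)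
Lemma asuperder_metric mu nu : asuperder S v (agl mu nu) = LM mu nu.
Proof.
pose w a m := v (Viel a m) 0.
have dV a m : asuperder S v (sc (V a m)) = w a m by rewrite -ajet_vielbein asuperder_jet.
have dE x : asuperder S v (sc (mpsC x)) = 0.
  by rewrite asuperder_scst_pair big1 // => p _; rewrite mps_derivC rmorph0 mulr0.
have Esym m n : E m n = E n m by rewrite -{1}minkowski_tr mxE.
have half a b : \sum_n (\sum_m w a m * sc (E m n)) * sc (V b n) = sc (mpsC h) * LM a b.
  have wE m : w a m = \sum_c sc (mpsC h) * LM a c * sc ((E *m vielbV) m c).
    by rewrite /w vE mulr_sumr; apply: eq_bigr => c _; rewrite aeuE mulrA.
  (* [E] squares to the identity, so raising and lowering the frame index cancel and the vielbein
     meets its inverse. *)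
  have id c : \sum_n (\sum_m sc ((E *m vielbV) m c) * sc (E m n)) * sc (V b n) =
      (b == c)%:R.
    transitivity (sc ((V *m (E *m (E *m vielbV))) b c)).
      rewrite mxE raddf_sum; apply: eq_bigr => n _ /=.
      rewrite rmorphM [RHS]scstC [(E *m _) n c]mxE raddf_sum /=; congr (_ * _).
      by apply: eq_bigr => m _; rewrite rmorphM [RHS]scstC Esym.
    by rewrite (mulmxA E) minkowski_sqr mul1mx mul_vielbV mxE rmorph_nat.
  under eq_bigr do under eq_bigr do rewrite wE mulr_suml.
  under eq_bigr do rewrite exchange_big mulr_suml.
  rewrite exchange_big (bigD1 b) //= [X in _ + X]big1 ?addr0 => [|c /negbTE cb].
    under eq_bigr do under eq_bigr do rewrite -mulrA.
    under eq_bigr do rewrite -mulr_sumr -mulrA.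
    by rewrite -mulr_sumr id eqxx mulr1.
  under eq_bigr do under eq_bigr do rewrite -mulrA.
  under eq_bigr do rewrite -mulr_sumr -mulrA.
  by rewrite -mulr_sumr id eq_sym cb mulr0.
have dsum (F : 'I_d -> L) : asuperder S v (sc (\sum_n F n)) = \sum_n asuperder S v (sc (F n)).
  by rewrite !raddf_sum.
have dEE m n : asuperder S v (sc (E m n)) = 0.
  by rewrite -(map_minkowski (@mpsC (d * d) K)) mxE dE.
rewrite /agl mxE dsum; under eq_bigr do rewrite asuperder_scst_deriv [V^T _ _]mxE dV.
under eq_bigr do rewrite [(V *m E) _ _]mxE dsum.
under eq_bigr do under eq_bigr do rewrite asuperder_scst_deriv dV dEE mul0r addr0.
rewrite big_split /= half (LMC mu nu).
have -> : \sum_n w nu n * sc (\sum_m V mu m * E m n) = sc (mpsC h) * LM nu mu.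
  rewrite -half; under [RHS]eq_bigr do rewrite mulr_suml.
  rewrite exchange_big; apply: eq_bigr => n _ /=.
  rewrite raddf_sum mulr_sumr; apply: eq_bigr => m _ /=.
  by rewrite -mulrA -rmorphM mulrC Esym.
by rewrite -mulrDl -!rmorphD h2 !rmorph1 mul1r.
Qed.
End Variation.

Definition alie_metric (X : vec) mu nu : A :=
  \sum_rho X rho 0 * t rho (agl mu nu) +
  \sum_rho (X rho (munit mu) * agl rho nu + X rho (munit nu) * agl mu rho).

Lemma alie_metricC X mu nu : alie_metric X mu nu = alie_metric X nu mu.
Proof.
rewrite /alie_metric /agl metricC; congr (_ + _).
by apply: eq_bigr => rho _; rewrite addrC (metricC mu) (metricC nu).
Qed.

(** The transport part of the Lie derivative of the metric yields the transport of the density. Each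
    of the two terms with a derivative of [X] is contracted with [cof], which is [a] times the
    density times the inverse metric, and yields [a] times the divergence. *)
Lemma asuperder_density (h a : K) (X : vec) (v : fld -> mi -> A) : h + h = 1 ->
  (forall mu m, v (Viel mu m) 0 = sc (mpsC h) * \sum_nu alie_metric X mu nu * aeu nu m) ->
  asuperder S v (adensity a) = \sum_rho X rho 0 * t rho (adensity a) +
     sc (mpsC (a + a)) * ((\sum_rho X rho (munit rho)) * adensity a).
Proof.
move=> h2 vE; rewrite asuperder_pow.
pose D := mps_pow (- \det g) (a - 1).
pose cof i j : A := sc (\adj g j i * - (mpsC a * D)).
under eq_bigr do under eq_bigr do
  rewrite (asuperder_metric h2 (alie_metricC X) vE) -/(cof _ _) mulrDl.
under eq_bigr do rewrite big_split /=.
rewrite big_split /=; congr (_ + _).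
  under eq_bigr do under eq_bigr do rewrite mulr_suml.
  under eq_bigr do rewrite exchange_big.
  rewrite exchange_big; apply: eq_bigr => rho _ /=.
  rewrite [t rho _]asuperder_pow mulr_sumr; apply: eq_bigr => i _.
  by rewrite mulr_sumr; apply: eq_bigr => j _; rewrite mulrA.
have DF : \det g * - (mpsC a * D) = mpsC a * mps_pow (- \det g) a.
  rewrite -[X in mps_pow _ X](subrK 1 a) mps_powD ?const_det_metric //.
  by rewrite mps_pow1 ?const_det_metric // -/D; ring.
have cofl rho i : \sum_j agl rho j * cof i j = sc (mpsC a) * adensity a *+ (rho == i).
  transitivity (sc (\sum_j g rho j * (\adj g j i) * - (mpsC a * D))).
    by rewrite raddf_sum; apply: eq_bigr => j _ /=; rewrite -mulrA rmorphM.
  have -> : \sum_j g rho j * \adj g j i * - (mpsC a * D) =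
      (g *m \adj g) rho i * - (mpsC a * D) by rewrite [in RHS]mxE mulr_suml.
  by rewrite mul_mx_adj mxE mulrnAl DF raddfMn /= rmorphM.
have cofr rho j : \sum_i agl i rho * cof i j = sc (mpsC a) * adensity a *+ (rho == j).
  rewrite -cofl; apply: eq_bigr => i _; rewrite /agl metricC; congr (_ * sc (_ * _)).
  by rewrite -{1}metric_tr -trmx_adj mxE.
under eq_bigr do under eq_bigr do (rewrite mulr_suml; under eq_bigr do rewrite mulrDl).
have X1 F : \sum_rho X rho (munit rho) * F = (\sum_rho X rho (munit rho)) * F.
  by rewrite mulr_suml.
transitivity ((\sum_i \sum_rho X rho (munit i) * \sum_j agl rho j * cof i j) +
   \sum_j \sum_rho X rho (munit j) * \sum_i agl i rho * cof i j).
  under eq_bigr do under eq_bigr do rewrite big_split /=.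
  under eq_bigr do rewrite big_split /=.
  rewrite big_split /=; congr (_ + _).
    apply: eq_bigr => i _; rewrite exchange_big; apply: eq_bigr => rho _.
    by rewrite mulr_sumr; apply: eq_bigr => j _; rewrite mulrA.
  rewrite exchange_big; apply: eq_bigr => j _; rewrite exchange_big.
  apply: eq_bigr => rho _.
  by rewrite mulr_sumr; apply: eq_bigr => i _; rewrite mulrA.
have diag (H : 'I_d -> 'I_d -> A) : (forall rho i, H rho i = sc (mpsC a) * adensity a *+ (rho == i)) ->
    \sum_i \sum_rho X rho (munit i) * H rho i =
    sc (mpsC a) * ((\sum_rho X rho (munit rho)) * adensity a).
  move=> HE; rewrite mulrA scstC -mulrA mulr_suml; apply: eq_bigr => i _.
  rewrite (bigD1 i) //= HE eqxx big1 ?addr0 // => rho /negbTE ri.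
  by rewrite HE ri mulr0.
by rewrite (diag _ cofl) (diag _ cofr) -mulrDl -!rmorphD.
Qed.

(** * The transformation of the graviton as a Lie derivative of the metric *)

Definition aChristoffel (h : K) rho mu nu : A :=
  sc (mpsC h) * \sum_sg agu rho sg *
    (t mu (agl sg nu) + t nu (agl sg mu) - t sg (agl mu nu)).

Definition apgraviton (z tw h : K) (c : 'I_d -> A) mu nu : A :=
  sc (mpsC z) * t mu (c nu) + sc (mpsC z) * t nu (c mu)
  - sc (mpsC tw) * \sum_rho c rho * aChristoffel h rho mu nu.

(** As [c] is [X] with its index lowered, d_mu c_nu + d_nu c_mu contains derivatives of the metric;
    the Christoffel term removes them and leaves the transport term. The derivatives of [X] survive.
    The leading 1 is the value of 1/zeta for which the two parts match. *)
Lemma pgraviton_lie (tw h : K) (X : vec) (c : 'I_d -> A) mu nu : tw * h = 1 ->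
  (forall rho nu, t nu (X rho 0) = X rho (munit nu)) ->
  (forall nu, c nu = \sum_sg agl nu sg * X sg 0) ->
  apgraviton 1 tw h c mu nu = alie_metric X mu nu.
Proof.
move=> twh tX cE; rewrite /apgraviton !rmorph1 !mul1r.
have aglC a b f : agl a b * f = f * agl a b by rewrite /agl scstC.
have gsym a b : agl a b = agl b a by rewrite /agl metricC.
have tc a b : t a (c b) = \sum_sg (X sg 0 * t a (agl b sg) + X sg (munit a) * agl b sg).
  rewrite cE raddf_sum; apply: eq_bigr => sg _ /=.
  by rewrite aglC atderM tX addrC.
have cu sg : \sum_rho c rho * agu rho sg = X sg 0.
  transitivity (\sum_tau X tau 0 * sc ((g *m metricV) tau sg)).
    under eq_bigr do rewrite cE mulr_suml.
    rewrite exchange_big; apply: eq_bigr => tau _ /=.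
    rewrite mxE raddf_sum mulr_sumr; apply: eq_bigr => rho _ /=.
    by rewrite aguE aglC -mulrA gsym rmorphM.
  rewrite mul_metricV (bigD1 sg) //= mxE eqxx rmorph1 mulr1 big1 ?addr0 // => tau.
  by move=> /negbTE ne; rewrite mxE ne rmorph0 mulr0.
pose T sg := t mu (agl sg nu) + t nu (agl sg mu) - t sg (agl mu nu).
have -> : sc (mpsC tw) * \sum_rho c rho * aChristoffel h rho mu nu = \sum_sg X sg 0 * T sg.
  transitivity (sc (mpsC tw) * (sc (mpsC h) * \sum_rho c rho * \sum_sg agu rho sg * T sg)).
    congr (_ * _); rewrite mulr_sumr; apply: eq_bigr => rho _.
    by rewrite /aChristoffel mulrA -scstC mulrA.
  rewrite mulrA -!rmorphM twh !rmorph1 mul1r.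
  under eq_bigr do rewrite mulr_sumr.
  rewrite exchange_big; apply: eq_bigr => sg _ /=.
  by rewrite -cu mulr_suml; apply: eq_bigr => rho _; rewrite mulrA.
rewrite !tc /alie_metric -!big_split -sumrB /=; apply: eq_bigr => sg _.
rewrite /T (gsym sg nu) (gsym sg mu) !mulrDr mulrN addrACA.
set x := X sg 0 * _ + _ * _; set y := X sg _ * _ + _ * _.
by rewrite opprB [x + y]addrC -addrA [x + _]addrC subrK addrC.
Qed.
End Metric.

(** * Weight and total derivatives *)

Section DensityWeight.
Variables (d N nH nS nI : nat) (K : numFieldType) (A : nzRingType).
Hypothesis d_gt0 : (0 < d)%N.
Local Notation mi := (mindex d).
Local Notation fld := (field d N nH nS nI).
Local Notation L := (mps (d * d) K).
Variable S : supermonomials L (xgen d N nH nS nI) (ygen d N) A.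
Local Notation vec := ('I_d -> mi -> A).
Local Notation term := ('I_d * mi * A)%type.
Local Notation t := (atder S).
Local Notation sc := (scst S).
Local Notation cs c := (scst S (mpsC c)).
Local Notation Viel mu m := (Vielbein N nH nS nI mu m : fld).
Variables (l : fld -> seq term) (h : K).
Hypothesis h2 : h + h = 1.
Hypothesis lV : forall X mu m,
  ev X (l (Viel mu m)) = cs h * \sum_nu alie_metric S X mu nu * aeu S nu m.

Lemma csM (x y : K) : cs (x * y) = cs x * cs y.
Proof. by rewrite !rmorphM. Qed.

Lemma adensityD (a b : K) : adensity S a * adensity S b = adensity S (a + b).
Proof. by rewrite /adensity mps_powD ?const_det_metric // rmorphM. Qed.

Lemma adensity0 : adensity S 0 = 1.
Proof. by rewrite /adensity mps_pow0 rmorph1. Qed.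

Lemma adensityA a b c f : a + b = c ->
  adensity S a * (adensity S b * f) = adensity S c * f.
Proof. by move=> <-; rewrite mulrA adensityD. Qed.

Lemma adensity_eq0 a f : adensity S a * f = 0 -> f = 0.
Proof.
by move=> E; rewrite -[f]mul1r -adensity0 -(addNr a) -adensityD -mulrA E mulr0.
Qed.

Lemma cst_eq0 (c : K) f : cs c * f = 0 -> c = 0 \/ f = 0.
Proof.
move=> E; have [->|c0] := eqVneq c 0; [by left | right].
by rewrite -[f]mul1r -(rmorph1 sc) -(rmorph1 (@mpsC (d * d) K)) -(mulVf c0) !rmorphM -mulrA E mulr0.
Qed.

Lemma asuperder_adensityM X (a : K) f0 :
  asuperder S (lie_jets S l X) f0 = \sum_rho X rho 0 * t rho f0 ->
  asuperder S (lie_jets S l X) (adensity S a * f0) =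
    \sum_rho X rho 0 * t rho (adensity S a * f0) +
    cs (a + a) * ((\sum_rho X rho (munit rho)) * (adensity S a * f0)).
Proof.
move=> f0E; rewrite {1}/adensity asuperder_scstM -/(adensity S a).
rewrite (asuperder_density d_gt0 a (X := X) h2) => [|mu m]; last first.
  by rewrite /lie_jets aiterD0 lV.
rewrite f0E mulrDl -!mulrA addrAC; congr (_ + _).
rewrite mulr_suml mulr_sumr -big_split; apply: eq_bigr => rho _ /=.
by rewrite atderM mulrDr !mulrA scstC.
Qed.

Lemma atder_cst mu (x : K) : t mu (cs x) = 0.
Proof.
by rewrite atder_scst big1 // => p _; rewrite mps_derivC rmorph0 mulr0.
Qed.

Lemma aiterD_unit mu f : aiterD t (munit mu) f = t mu f.
Proof. by rewrite -[munit mu]add0r aiterD_atderU aiterD0. Qed.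

Lemma scst_scalar_mx (x : 'I_d -> A) rho :
  x rho = \sum_sg sc ((1%:M : 'M[L]_d) rho sg) * x sg.
Proof.
rewrite (bigD1 rho) //= mxE eqxx rmorph1 mul1r big1 ?addr0 // => sg.
by rewrite eq_sym => /negbTE ne; rewrite mxE ne rmorph0 mul0r.
Qed.

Section Uniqueness.
Variables (B : nzRingType) (emb : B -> A).
Hypotheses (emb0 : emb 0 = 0) (emb1 : emb 1 = 1).

Definition is_covariant f := forall xi : 'I_d -> mi -> B,
  asuperder S (lie_jets S l (embv emb xi)) f = \sum_rho emb (xi rho 0) * t rho f.

Lemma adensity_weight_unique (a b : K) f f' : is_covariant f -> is_covariant f' ->
  adensity S a * f = adensity S b * f' -> f <> 0 -> a = b.
Proof.
move=> fc fc' E f0.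
pose r0 := Ordinal d_gt0.
(* The only nonzero jet coordinate is d_r0 xi^r0, so the divergence is 1; the transport terms agree
   because [E] identifies the two densities. *)
pose xi rho (I : mi) : B := ((rho == r0) && (I == munit r0))%:R.
have := asuperder_adensityM a (fc xi); rewrite E (asuperder_adensityM b (fc' xi)) => /addrI.
have -> : \sum_rho embv emb xi rho (munit rho) = 1.
  rewrite (bigD1 r0) //= /embv /xi !eqxx /= emb1 big1 ?addr0 // => rho /negbTE ->.
  exact: emb0.
rewrite !mul1r -E => /eqP; rewrite eq_sym -subr_eq0 -mulrBl -!rmorphB => /eqP /cst_eq0[|].
  rewrite opprD addrACA -mulr2n => /eqP; rewrite mulrn_eq0 subr_eq0 /= => /eqP //.
by move/adensity_eq0.
Qed.
End Uniqueness.

(** * Variation along a ghost, modulo total derivatives *)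

Section TotalDerivative.
Variables (kap : K) (phis : 'I_d -> fld) (Q Q' : 'M[L]_d) (c : 'I_d -> A).
Hypotheses (kap0 : kap != 0) (phis_inj : injective phis) (odd_phis : forall sg, is_odd (phis sg)).
Hypothesis QQ' : Q *m Q' = 1%:M.
Hypothesis cE : forall rho, c rho = \sum_sg sc (Q rho sg) * ajet S (phis sg) 0.

(** The jets of the vector field [kap] times [c], whose derivatives are total derivatives; this is
    the [X] substituted for the real jets. *)
Definition ghost_jets : vec := fun rho J => cs kap * aiterD t J (c rho).

Lemma t_cst mu (x : K) f : t mu (cs x * f) = cs x * t mu f.
Proof.
by rewrite atderM atder_cst mul0r add0r.
Qed.

Lemma t_ghost_jets mu rho J : t mu (ghost_jets rho J) = ghost_jets rho (J + munit mu).
Proof. by rewrite /ghost_jets t_cst aiterD_atderU. Qed.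

Lemma t_not_involving mu f : (forall sg I, pderiv S (phis sg, I) f = 0) ->
  forall sg I, pderiv S (phis sg, I) (t mu f) = 0.
Proof.
move=> f0 sg I; have [I0|I0] := posnP (I mu); first by rewrite pderiv_atder0 // f0 raddf0.
have -> : I = [ffun nu => (I nu - (nu == mu))%N] + munit mu.
  apply/ffunP => nu; rewrite addmUE ffunE; case: eqP => [->|_]; last by rewrite subn0 addn0.
  by rewrite subnK.
by rewrite pderiv_atder !f0 raddf0 addr0.
Qed.

Lemma weight_one_total_derivative (a : K) f0 (f := adensity S a * f0) :
  asuperder S (lie_jets S l ghost_jets) f0 = \sum_rho ghost_jets rho 0 * t rho f0 ->
  (forall sg I, pderiv S (phis sg, I) f = 0) -> ~ (exists x : K, f = cs x) ->
  a + a = 1 <->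
  exists J : 'I_d -> A, asuperder S (lie_jets S l ghost_jets) f = \sum_mu t mu (J mu).
Proof.
move=> f0E pdf fnc; rewrite (asuperder_adensityM a f0E) -/f.
pose X := ghost_jets; rewrite -/X.
have tXf rho : t rho (X rho 0 * f) = X rho (munit rho) * f + X rho 0 * t rho f.
  by rewrite atderM t_ghost_jets add0r.
split=> [->|[J JE]].
  exists (fun rho => X rho 0 * f); under [RHS]eq_bigr do rewrite tXf.
  by rewrite big_split !rmorph1 mul1r addrC mulr_suml.
apply/eqP; apply/negPn/negP => w1.
(* [G sg] multiplies the undifferentiated ghost [phis sg] in (1 - w) X^rho d_rho f. Its contraction
   with [Q'] later isolates a single d_tau f. *)
pose w := a + a; pose G sg := \sum_rho cs ((1 - w) * kap) * sc (Q rho sg) * t rho f.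
have GE : \sum_sg ajet S (phis sg) 0 * G sg = cs (1 - w) * \sum_rho X rho 0 * t rho f.
  under eq_bigr do rewrite mulr_sumr.
  rewrite exchange_big mulr_sumr; apply: eq_bigr => rho _ /=.
  rewrite {1}/X /ghost_jets aiterD0 cE mulrA mulrA -csM mulr_sumr mulr_suml.
  apply: eq_bigr => sg _; rewrite !mulrA; congr (_ * _).
  by rewrite -(scstC S (mpsC _) (ajet S (phis sg) 0)) -mulrA -(scstC S (Q rho sg)) mulrA.
have G0 : forall sg, G sg = 0.
  (* Subtracting [w] times the divergence of [X f] from the variation removes the derivatives of the
     ghost and leaves a total derivative. *)
  apply: (@linear_total_derivative _ _ _ _ _ _ _ S phis G
    (fun mu => J mu - cs w * (X mu 0 * f))) => //.
    move=> sg tau I; rewrite raddf_sum big1 // => rho _ /=.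
    have pdsc x : pderiv S (phis tau, I) (sc x) = 0.
      by rewrite pderiv_scst; case: (phis tau) (odd_phis tau).
    by rewrite -rmorphM pderivM pdsc mul0r add0r t_not_involving ?mulr0.
  rewrite GE; under [RHS]eq_bigr do rewrite raddfB /= t_cst tXf.
  rewrite sumrB -JE (_ : cs (1 - w) = 1 - cs w) ?mulrBl ?mul1r.
    have -> : \sum_i cs w * (X i (munit i) * f + X i 0 * t i f) =
        cs w * \sum_i (X i (munit i) * f + X i 0 * t i f) by rewrite mulr_sumr.
    rewrite big_split mulrDr /=.
    by rewrite mulr_suml opprD addrA addrK.
  by rewrite !rmorphB !rmorph1.
have tf0 tau : t tau f = 0.
  have wk : (1 - w) * kap != 0 by rewrite mulf_neq0 // subr_eq0 eq_sym.
  have : \sum_sg G sg * sc (Q' sg tau) = 0.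
    by rewrite big1 // => sg _; rewrite G0 mul0r.
  have -> : \sum_sg G sg * sc (Q' sg tau) = cs ((1 - w) * kap) * t tau f.
    transitivity (\sum_rho cs ((1 - w) * kap) * (sc ((Q *m Q') rho tau) * t rho f)).
      under eq_bigr do rewrite mulr_suml.
      rewrite exchange_big; apply: eq_bigr => rho _.
      rewrite mxE raddf_sum mulr_suml mulr_sumr; apply: eq_bigr => sg _ /=.
      by rewrite -[LHS]mulrA -(scstC S (Q' sg tau) (t rho f)) (rmorphM sc (Q rho sg)) !mulrA.
    rewrite QQ' (bigD1 tau) //= mxE eqxx rmorph1 mul1r big1 ?addr0 // => rho /negbTE ne.
    by rewrite mxE ne rmorph0 mul0r mulr0.
  by case/cst_eq0 => // E; rewrite E eqxx in wk.
(* One direction in which the total derivative vanishes is enough, and positive dimension provides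
   one. *)
by apply/fnc/pderiv_eq0_const/(atder_eq0_pderiv (tf0 (Ordinal d_gt0))).
Qed.
End TotalDerivative.
End DensityWeight.

(** * Functionals of particle fields *)

Section Functionals.
Variables (R : realType) (M : model R).
Local Notation d := (Defs.dim M).
Local Notation K := R[i].
Local Notation mi := (mindex d).
Local Notation fld := (field d (gdim M) (hdim M) (sdim M) (idim M)).
Local Notation xg := (xgen d (gdim M) (hdim M) (sdim M) (idim M)).
Local Notation yg := (ygen d (gdim M)).
Local Notation L := (mps (d * d) K).
Local Notation A := (superalg L xg yg).
Local Notation vec := ('I_d -> mi -> A).
Local Notation S := (superalg_monomials L xg yg).
Local Notation t := (atder S).
Local Notation Viel mu m := (Vielbein (gdim M) (hdim M) (sdim M) (idim M) mu m : fld).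
Local Notation Gh y := (Gho (hdim M) (sdim M) (idim M) y : fld).

Lemma superderE v f : @superder R M v f = asuperder S v f.
Proof. exact: erefl. Qed.

Lemma tderE mu f : @tder R M mu f = t mu f.
Proof. exact: erefl. Qed.

Lemma glE mu nu : @gl R M mu nu = agl S mu nu.
Proof. exact: erefl. Qed.
Lemma guE mu nu : @gu R M mu nu = agu S mu nu.
Proof. exact: erefl. Qed.
Lemma euE mu m : @eu R M mu m = aeu S mu m.
Proof. exact: erefl. Qed.

Let congrM (a a' b b' : A) : a = a' -> b = b' -> a * b = a' * b'.
Proof. by move=> -> ->. Qed.
Let congrD (a a' b b' : A) : a = a' -> b = b' -> a + b = a' + b'.
Proof. by move=> -> ->. Qed.
Let congrB (a a' b b' : A) : a = a' -> b = b' -> a - b = a' - b'.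
Proof. by move=> -> ->. Qed.

Lemma tder_gl rho mu nu : tder rho (@gl R M mu nu) = t rho (agl S mu nu).
Proof. exact: (etrans (tderE rho _) (congr1 (t rho) (glE mu nu))). Qed.

Lemma ChristoffelE rho mu nu :
  @Christoffel R M rho mu nu = aChristoffel S (2^-1)%:C%C rho mu nu.
Proof.
apply: (congrM (erefl _)); apply: eq_bigr => sg _; apply: congrM; first exact: guE.
by apply: congrB; [apply: congrD|]; exact: tder_gl.
Qed.

Lemma PgravitonE c mu nu : @Pgraviton R M c mu nu =
  apgraviton S ((zeta M)^-1)%:C%C 2%:C%C (2^-1)%:C%C c mu nu.
Proof.
apply: congrB.
  by apply: congrD; apply: (congrM (erefl _)); exact: tderE.
apply: (congrM (erefl _)); apply: eq_bigr => rho _; apply: (congrM (erefl _)).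
exact: ChristoffelE.
Qed.

Definition vlie (X : vec) (phi : fld) : A :=
  @lie R M (fun rho => X rho 0) (fun mu rho => X rho (munit mu)) phi.

Lemma lie_metricE (X : vec) mu nu :
  @lie_metric R M (fun rho => X rho 0) (fun mu rho => X rho (munit mu)) mu nu =
  alie_metric S X mu nu.
Proof.
apply: congrD; apply: eq_bigr => rho _.
  by apply: (congrM (erefl _)); exact: tder_gl.
by apply: congrD; apply: (congrM (erefl _)); exact: glE.
Qed.

Lemma lie_vielbein X mu m :
  vlie X (Viel mu m) = scst S (mpsC (2^-1)%:C%C) * \sum_nu alie_metric S X mu nu * aeu S nu m.
Proof.
apply: (congrM (erefl _)); apply: eq_bigr => nu _.
by apply: congrM; [exact: lie_metricE | exact: euE].
Qed.

Lemma rcstC (r : R) (f : A) : (rcst M r : A) * f = f * rcst M r.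
Proof. exact: (scstC S (mpsC r%:C%C) f). Qed.

Lemma linrep_transport f : linrep (fun X : vec => @transport R M (fun rho => X rho 0) f : A).
Proof. by apply: linrep_sum => rho; apply: linrepMr; exact: linrep_jet. Qed.

(** Supplies the coefficient lists on which covariance and weight are computed. All factors stand to
    the right of the vector field, except the constant 1/2 for the vielbein, which is central. *)
Lemma linrep_lie phi : linrep (fun X => vlie X phi).
Proof.
case: phi => [mu m|[a mu|i|b al k|rho|a]|[rho|rho|a|a]].
- apply: linrepMl; first exact: rcstC.
  apply: linrep_sum => nu; apply: linrepMr; apply: linrepD; first exact: linrep_transport.
  by apply: linrep_sum => rho; apply: linrepD; apply: linrepMr; exact: linrep_jet.
- apply: linrepD; first exact: linrep_transport.
  by apply: linrep_sum => rho; apply: linrepMr; exact: linrep_jet.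
- exact: linrep_transport.
- apply: linrepD.
    by apply: linrep_sum => rho; apply: linrepMr; exact: linrep_jet.
  do 5 (apply: linrep_sum => ?); do 4 apply: linrepMr.
  by apply: linrepB; apply: linrep_sum => sg; apply: linrepD; apply: linrepMr; exact: linrep_jet.
- apply: linrepB; first exact: linrep_transport.
  by apply: linrep_sum => sg; apply: linrepMr; exact: linrep_jet.
- exact: linrep_transport.
- apply: linrepD; first exact: linrep_transport.
  by apply: linrep_sum => sg; apply: linrepMr; exact: linrep_jet.
- apply: linrepB; first exact: linrep_transport.
  by apply: linrep_sum => sg; apply: linrepMr; exact: linrep_jet.
- exact: linrep_transport.
- exact: linrep_transport.
Qed.

Lemma rcst0 : rcst M 0 = 0 :> A.
Proof. exact: (etrans (congr1 (scst S) (rmorph0 (@mpsC _ K))) (rmorph0 (scst S))). Qed.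
Lemma rcst1 : rcst M 1 = 1 :> A.
Proof. exact: (etrans (congr1 (scst S) (rmorph1 (@mpsC _ K))) (rmorph1 (scst S))). Qed.

Lemma not_involves_odd phi f : ~ involves_odd phi f -> forall I, pderiv S (Gh phi, I) f = 0.
Proof.
move=> nf I.
have E : pderiv S (Gh phi, I) f = \sum_(k <- msupp f) if (phi, I) \in k.2 then
    sterm ((-1) ^+ ninv [fset (phi, I)]%fset k.2 * mcoeff k f) (k.1, (k.2 `\ (phi, I))%fset)
    else 0 by exact: erefl.
rewrite {}E big_seq big1 // => k kf; case: ifP => // h.
by case: nf; exists I, k.
Qed.

Lemma not_involves_even phi f : ~ involves_even phi f ->
  forall I, pderiv S (Bos phi : fld, I) f = 0.
Proof.
move=> nf I.
have E : pderiv S (Bos phi : fld, I) f = \sum_(k <- msupp f)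
    sterm (mcoeff k f *+ k.1 (inr (phi, I))) (divcm k.1 (ucm (inr (phi, I))), k.2)
  by exact: erefl.
rewrite {}E big_seq big1 // => k kf.
have -> : k.1 (inr (phi, I)) = 0%N.
  by apply/eqP; rewrite cmE_eq0; apply/negP => h; case: nf; exists I, k.
exact: (@sterm0 _ _ _ _ S).
Qed.

Section LieTerms.
Variable l : fld -> seq ('I_d * mi * A).
Hypothesis lE : forall phi X, vlie X phi = ev X (l phi).

Lemma ev_lie_vielbein X mu m : ev X (l (Viel mu m)) =
  scst S (mpsC (2^-1)%:C%C) * \sum_nu alie_metric S X mu nu * aeu S nu m.
Proof. exact: (etrans (esym (lE _ _)) (lie_vielbein _ _ _)). Qed.

(** Identifies the prolongation by [xtder], with its chain rule in [xi], with the one on coefficient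
    lists. *)
Lemma covariantP f : covariant f -> is_covariant S l (rcst M) f.
Proof.
move=> fc xi; apply: etrans (fc xi).
suff E : lie_jets S l (embv (rcst M) xi) =
    fun phi I => Defs.iterD (@xtder R M) I (lie_xi phi) xi.
  exact: (congr1 (fun v => asuperder S v f) E).
apply/funext => phi; apply/funext => I.
have lieE : lie_xi phi = fun z : 'I_d -> mi -> R => ev (embv (rcst M : R -> A) z) (l phi).
  by apply/funext => z; exact: (lE phi (embv (rcst M : R -> A) z)).
have tM mu (a b : A) : t mu (a * b) = t mu a * b + a * t mu b by exact: atderM.
have := @aiterD_xt_ev d A t (fun mu => raddfB (t mu)) tM R (rcst M : R -> A)
  (fun mu r => atder_cst S mu r%:C%C) I (l phi).
rewrite -lieE => /(congr1 (fun F => F xi)) /esym E; exact: E.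
Qed.

Local Notation kap := ((kappa M)%:C%C : K).

Definition ghost_field (c : 'I_d -> A) : vec := fun rho J => aiterD t J (c rho).

Lemma ghost_jetsE (c : 'I_d -> A) phi :
  ev (ghost_jets S kap c) (l phi) = rcst M (kappa M) * vlie (ghost_field c) phi.
Proof.
exact: etrans (evMl (rcst M (kappa M) : A) (ghost_field c) (l phi))
  (congr1 (fun x => (rcst M (kappa M) : A) * x) (esym (lE _ _))).
Qed.

Lemma lie_ghost_field (c : 'I_d -> A) phi :
  vlie (ghost_field c) phi = lie c (fun mu rho => tder mu (c rho)) phi.
Proof.
have E0 : (fun rho => ghost_field c rho 0) = c.
  by apply/funext => rho; exact: aiterD0.
have E1 : (fun mu rho => ghost_field c rho (munit mu)) = fun mu rho => tder mu (c rho).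
  by apply/funext => mu; apply/funext => rho; exact: aiterD_unit.
exact: (congr2 (fun x y => @lie R M x y phi) E0 E1).
Qed.

Hypothesis zeta1 : zeta M = 1.

(** The factor kappa / 2 of [dvielbein] supplies both the [kap] of [ghost_jets] and the one half in
    the Lie derivative of the vielbein; [zeta1] makes [pgraviton_lie] applicable. *)
Lemma dvielbein_lie (b c : 'I_d -> A) mu m :
  (forall nu, b nu = \sum_sg agl S nu sg * c sg) ->
  dvielbein (@Pgraviton R M b) mu m = ev (ghost_jets S kap c) (l (Viel mu m)).
Proof.
move=> bE; rewrite ghost_jetsE.
have gE nu : @Pgraviton R M b mu nu = alie_metric S (ghost_field c) mu nu.
  apply: (etrans (PgravitonE b mu nu)).
  have -> : ((zeta M)^-1)%:C%C = 1 by rewrite zeta1 invr1.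
  apply: pgraviton_lie.
  - exact: dim_gt0.
  - by rewrite -rmorphM mulfV ?rmorph1 // pnatr_eq0.
  - by move=> rho sg; rewrite /ghost_field aiterD0 aiterD_unit.
  - by move=> sg; rewrite bE; apply: eq_bigr => rho _; rewrite /ghost_field aiterD0.
have kE : rcst M (kappa M / 2) = (rcst M (kappa M) : A) * scst S (mpsC (2^-1)%:C%C).
  have e : (kappa M / 2)%:C%C = kap * (2^-1)%:C%C by rewrite rmorphM.
  exact: (etrans (congr1 (fun x => scst S (mpsC x)) e) (csM S _ _)).
have sE : \sum_nu @Pgraviton R M b mu nu * eu nu m =
    \sum_nu alie_metric S (ghost_field c) mu nu * aeu S nu m.
  by apply: eq_bigr => nu _; apply: congrM; [exact: gE | exact: euE].
apply: (etrans (congrM kE sE)); apply: (etrans (esym (mulrA _ _ _))).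
by apply: (congrM (erefl _)); exact/esym/lie_vielbein.
Qed.

Lemma CuE rho : @Cu R M rho =
  \sum_sg scst S (metricV d K rho sg) * ajet S (Gh (Ghost _ sg)) 0.
Proof.
by apply: eq_bigr => sg _; apply: (congrM _ (erefl _)); exact: (etrans (guE _ _) (aguE _ _ _)).
Qed.

(** The excluded fields are those on which [P] has a formula of its own. For the vielbein, C_rho is
    recovered by lowering the index of [Cu]. *)
Lemma P_fieldE phi : (forall rho, phi <> Gh (Ghost _ rho)) ->
  (forall rho, phi <> Gh (AntiGhost _ rho)) -> (forall rho, phi <> Bos (LautrupB _ _ _ _ rho)) ->
  P_field phi = ev (ghost_jets S kap (@Cu R M)) (l phi).
Proof.
move=> nC nCb nB.
have gen : rcst M (kappa M) * lie (@Cu R M) (fun mu rho => tder mu (Cu rho)) phi =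
    ev (ghost_jets S kap (@Cu R M)) (l phi).
  apply: (etrans _ (esym (ghost_jetsE _ _))).
  by apply: (congrM (erefl _)); exact/esym/lie_ghost_field.
case: phi nC nCb nB gen => [mu m|[a mu|i|b al k|rho|a]|[rho|rho|a|a]] nC nCb nB gen.
- apply: dvielbein_lie => nu; apply: esym.
  apply: (etrans _ (lower_raise (dim_gt0 M) S (fun rho => ajet S (Gh (Ghost _ rho)) 0) nu)).
  apply: eq_bigr => sg _; apply: (congrM (erefl _)).
  by apply: eq_bigr => rho _; apply: (congrM (guE _ _)); exact: erefl.
- exact: gen.
- exact: gen.
- exact: gen.
- by case: (nB rho).
- exact: gen.
- by case: (nC rho).
- by case: (nCb rho).
- exact: gen.
- exact: gen.
Qed.

Local Notation Cbar := (fun rho => ajet S (Gh (AntiGhost _ rho)) 0).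

Lemma Pbar_fieldE phi : (forall rho, phi <> Gh (Ghost _ rho)) ->
  (forall rho, phi <> Gh (AntiGhost _ rho)) ->
  Pbar_field phi = ev (ghost_jets S kap Cbar) (l phi).
Proof.
move=> nC nCb.
have gen : rcst M (kappa M) * lie Cbar (fun mu rho => tder mu (Cbar rho)) phi =
    ev (ghost_jets S kap Cbar) (l phi).
  apply: (etrans _ (esym (ghost_jetsE _ _))).
  by apply: (congrM (erefl _)); exact/esym/lie_ghost_field.
case: phi nC nCb gen => [mu m|[a mu|i|b al k|rho|a]|[rho|rho|a|a]] nC nCb gen.
- apply: dvielbein_lie => nu.
  by apply: eq_bigr => sg _; apply: (congrM (glE _ _)); exact: erefl.
- exact: gen.
- exact: gen.
- exact: gen.
(* On B^rho, [\bar P] is the Lie derivative along \bar C with kappa distributed over its two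
   terms. *)
- apply: etrans gen; apply: (etrans (esym (mulrBr _ _ _))).
  exact: erefl.
- exact: gen.
- by case: (nC rho).
- by case: (nCb rho).
- exact: gen.
- exact: gen.
Qed.

(** [v] has to be a Lie derivative only on the fields that [f] involves. There the two prolongations
    coincide, because [t] shifts the jets of [X]. *)
Lemma evolutionaryE (v : fld -> A) (X : vec) f :
  (forall mu rho J, t mu (X rho J) = X rho (J + munit mu)) ->
  (forall phi I, pderiv S (phi, I) f != 0 -> v phi = ev X (l phi)) ->
  evolutionary v f = asuperder S (lie_jets S l X) f.
Proof.
move=> tX vE; apply: (etrans (superderE _ _)); apply: eq_asuperder => phi I /vE E.
have tM mu (a b : A) : t mu (a * b) = t mu a * b + a * t mu b by exact: atderM.
apply: (etrans (congr1 (aiterD t I) E)).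
exact: (aiterD_ev (fun mu => raddfB (t mu)) tM I (l phi) tX).
Qed.

Lemma half_weight (w : R) : (w / 2)%:C%C + (w / 2)%:C%C = w%:C%C :> K.
Proof. by rewrite -rmorphD -splitr. Qed.

Lemma half_weight_inj (v w : R) :
  (v / 2)%:C%C + (w / 2)%:C%C = (1 / 2)%:C%C :> K -> 1 - w = v.
Proof.
rewrite -rmorphD -mulrDl => /complexI.
have n2 : 2^-1 != 0 :> R by rewrite invr_eq0 pnatr_eq0.
by move/(mulIf n2) => <-; rewrite addrK.
Qed.

Lemma real_complex_eq1 (w : R) : w = 1 <-> w%:C%C = 1 :> K.
Proof.
by split=> [->|/eqP]; [rewrite rmorph1 | rewrite fmorph_eq1 => /eqP].
Qed.

Lemma weight_iff (w : R) (f0 : A) (v : fld -> A) (phis : 'I_d -> fld) (Q Q' : 'M[L]_d)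
    (c : 'I_d -> A) (f := (density M w : A) * f0) :
  injective phis -> (forall sg, is_odd (phis sg)) -> Q *m Q' = 1%:M ->
  (forall rho, c rho = \sum_sg scst S (Q rho sg) * ajet S (phis sg) 0) ->
  covariant f0 -> ~ constant_functional f -> (forall sg I, pderiv S (phis sg, I) f = 0) ->
  (forall phi I, pderiv S (phi, I) f != 0 -> v phi = ev (ghost_jets S kap c) (l phi)) ->
  w = 1 <-> eqTD (evolutionary v f) 0.
Proof.
move=> phis_inj phis_odd QQ' cE f0cov fnc fphis vE.
have kap0 : kap != 0 by rewrite fmorph_eq0 kappa_neq0.
have h2 : (2^-1)%:C%C + (2^-1)%:C%C = 1 :> K.
  by rewrite -[X in X%:C%C]mul1r half_weight rmorph1.
have tX mu rho J : t mu (ghost_jets S kap c rho J) = ghost_jets S kap c rho (J + munit mu).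
  exact: t_ghost_jets.
have vf := evolutionaryE tX vE.
have f0E := covariance_extend rcst0 rcst1 (covariantP f0cov) (ghost_jets S kap c).
have := weight_one_total_derivative (dim_gt0 M) h2 ev_lie_vielbein kap0 phis_inj phis_odd
  QQ' cE (a := (w / 2)%:C%C) f0E fphis fnc.
rewrite half_weight => iffw.
have w1 := real_complex_eq1 w.
split=> [/w1 /iffw[J JE]|[J JE]].
  by exists J; apply: (etrans (subr0 _)); apply: (etrans vf); exact: JE.
apply/w1/iffw; exists J; apply: (etrans (esym vf)).
by apply: (etrans (esym (subr0 _))); exact: JE.
Qed.

Lemma BRST_iff w i j (f : functional M) : CQ w i j f -> ~ constant_functional f ->
  ~ involves_C f -> ~ involves_Cbar f -> ~ involves_B f ->
  w = 1 <-> eqTD (BRST f) 0.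
Proof.
move=> [f0 [f0cov _ fE]] fnc nC nCb nB.
have pdC rho I : pderiv S (Gh (Ghost _ rho), I) f = 0.
  by apply: not_involves_odd => h; apply: nC; exists rho.
have pdCb rho I : pderiv S (Gh (AntiGhost _ rho), I) f = 0.
  by apply: not_involves_odd => h; apply: nCb; exists rho.
have pdB rho I : pderiv S (Bos (LautrupB _ _ _ _ rho) : fld, I) f = 0.
  by apply: not_involves_even => h; apply: nB; exists rho.
move: fnc pdC pdCb pdB; rewrite {nC nCb nB}fE => fnc pdC pdCb pdB.
apply: (@weight_iff w f0 (@P_field R M) (fun rho => Gh (Ghost _ rho)) (metricV d K)
  (ametric d K) (@Cu R M)).
- by move=> rho rho' [].
- by [].
- exact: mul_Vmetric (dim_gt0 M).
- exact: CuE.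
- exact: f0cov.
- exact: fnc.
- exact: pdC.
- move=> phi I nz; apply: P_fieldE => rho E; move: nz; rewrite E.
  + by rewrite pdC eqxx.
  + by rewrite pdCb eqxx.
  + by rewrite pdB eqxx.
Qed.

Lemma antiBRST_iff w i j (f : functional M) : CQ w i j f -> ~ constant_functional f ->
  ~ involves_C f -> ~ involves_Cbar f ->
  w = 1 <-> eqTD (antiBRST f) 0.
Proof.
move=> [f0 [f0cov _ fE]] fnc nC nCb.
have pdC rho I : pderiv S (Gh (Ghost _ rho), I) f = 0.
  by apply: not_involves_odd => h; apply: nC; exists rho.
have pdCb rho I : pderiv S (Gh (AntiGhost _ rho), I) f = 0.
  by apply: not_involves_odd => h; apply: nCb; exists rho.
move: fnc pdC pdCb; rewrite {nC nCb}fE => fnc pdC pdCb.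
apply: (@weight_iff w f0 (@Pbar_field R M) (fun rho => Gh (AntiGhost _ rho)) 1%:M 1%:M Cbar).
- by move=> rho rho' [].
- by [].
- exact: mulmx1.
- by move=> rho; exact: scst_scalar_mx.
- exact: f0cov.
- exact: fnc.
- exact: pdCb.
- move=> phi I nz; apply: Pbar_fieldE => rho E; move: nz; rewrite E.
  + by rewrite pdC eqxx.
  + by rewrite pdCb eqxx.
Qed.

(** Exponents add under multiplication, hence the witness [1 - w]. For any other [v], the same
    functional has weight [v + w] with covariant factor [f0] and weight 1 with factor [f1], and [f0]
    is nonzero because [f] is. *)
Lemma weight_one_unique w i j (f : functional M) : CQ w i j f -> f <> 0 ->
  exists! v : R, CQ 1 i j (density M v * f).
Proof.
move=> [f0 [f0cov bf0 fE]] f_neq0; exists (1 - w); split.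
  have e : ((1 - w) / 2)%:C%C + (w / 2)%:C%C = (1 / 2)%:C%C :> K.
    by rewrite -rmorphD -mulrDl subrK.
  exists f0; split; [exact: f0cov | exact: bf0 |].
  apply: (etrans (congr1 (fun z => (density M (1 - w) : A) * z) fE)).
  exact: (adensityA (dim_gt0 M) S f0 e).
move=> v [f1 [f1cov _ E0]].
have E := etrans (esym (congr1 (fun z => (density M v : A) * z) fE)) E0.
have f0_neq0 : f0 <> 0.
  move=> f00; apply: f_neq0; apply: (etrans fE).
  exact: (etrans (congr1 (fun z => (density M w : A) * z) f00) (mulr0 _)).
have h2 : (2^-1)%:C%C + (2^-1)%:C%C = 1 :> K.
  by rewrite -[X in X%:C%C]mul1r half_weight rmorph1.
have E' : adensity S ((v / 2)%:C%C + (w / 2)%:C%C) * f0 = adensity S (1 / 2)%:C%C * f1.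
  exact: (etrans (esym (adensityA (dim_gt0 M) S f0 (erefl _))) E).
exact: (half_weight_inj (adensity_weight_unique (dim_gt0 M) h2 ev_lie_vielbein rcst0 rcst1
  (covariantP f0cov) (covariantP f1cov) E' f0_neq0)).
Qed.
End LieTerms.
End Functionals.

Theorem lemma3p5 (R : realType) (M : model R) (zeta1 : zeta M = 1) :
  (forall (w : R) (i j : int) (f : functional M),
     CQ w i j f -> ~ constant_functional f ->
     ~ involves_C f -> ~ involves_Cbar f ->
     (~ involves_B f -> (w = 1 <-> eqTD (BRST f) 0))
     /\ (w = 1 <-> eqTD (antiBRST f) 0))
  /\
  (forall (w : R) (i j : int) (f : functional M),
     CQ w i j f -> f <> 0 ->
     exists! v : R, CQ 1 i j (density M v * f)).
Proof.
(* The coefficient lists of the Lie derivatives of all fields are chosen at once. *)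
have [l lE] := choice (@linrep_lie R M).
split=> [w i j f fCQ fnc nC nCb|w i j f]; last exact: (weight_one_unique lE).
split=> [nB|]; first exact: (BRST_iff lE zeta1 fCQ).
exact: (antiBRST_iff lE zeta1 fCQ).
Qed.
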